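(* Let $q(t,z)$ be absolutely integrable (in $t$), with scattering functions $a(\lambda)$ and $b(\lambda)$ at $z=0$. Let $\lambda_0\in\mathbb{C}$ satisfy $\operatorname{Im}\lambda_0>0$ and $a(\lambda_0)\neq 0$ (that is, $\lambda_0$ is not an eigenvalue of $q$), and let the nontrivial vector function $\psi=(\psi_1(t,z),\psi_2(t,z))^T$ satisfy $$\frac{\partial}{\partial t}\psi=P(q,\lambda_0)\,\psi,\qquad \frac{\partial}{\partial z}\psi=M(q,\lambda_0)\,\psi .$$ Let $\Sigma=\Psi\Lambda_0\Psi^{-1}$, where $$\Psi=\begin{pmatrix}\psi_1&\psi_2^*\\ \psi_2&-\psi_1^*\end{pmatrix},\qquad \Lambda_0=\begin{pmatrix}\lambda_0&0\\0&\lambda_0^*\end{pmatrix},$$ and define $$\tilde q(t,z)=q(t,z)-2j(\lambda_0-\lambda_0^* )\frac{\psi_2^*(t,z)\psi_1(t,z)}{|\psi_1(t,z)|^2+|\psi_2(t,z)|^2}.$$ Then: (a) If $v(t,z;q,\mu)$ satisfies $\partial_t v=P(q,\mu)v$ and $\partial_z v=M(q,\mu)v$, then $u(t,z;\tilde q,\mu)=(\mu I-\Sigma)\,v(t,z;q,\mu)$ satisfies $\partial_t u=P(\tilde q,\mu)u$ and $\partial_z u=M(\tilde q,\mu)u$. (b) Assume that (at $z=0$, writing $\psi_i(t)=\psi_i(t,0)$) there are non-zero constants $\psi_1^+,\psi_2^-$ with $$\lim_{t\to+\infty}e^{j\lambda_0 t}\psi_1(t)=\psi_1^+,\qquad \lim_{t\to-\infty}e^{-j\lambda_0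 t}\psi_2(t)=\psi_2^-.$$ Then the discrete spectrum of $\tilde q(t,z)$ consists of the eigenvalues of $q(t,z)$ and also $\lambda_0$ (and $\lambda_0^*$). Moreover, let $\tilde a(\lambda)$ and $\tilde b(\lambda)$ denote the scattering functions of $\tilde q(t):=\tilde q(t,z=0)$, and let $\tilde Q_c$, $\tilde Q_d$ (resp. $Q_c$, $Q_d$) denote the continuous spectrum and the discrete spectral amplitudes of $\tilde q$ (resp. $q$) at $z=0$. Then $$\tilde a(\lambda)=\frac{\lambda-\lambda_0}{\lambda-\lambda_0^*}\,a(\lambda)\quad\text{for }\lambda\in\mathbb{C}^+,$$ $$\tilde b(\lambda)=b(\lambda)\quad\text{for }\lambda\in\mathbb{R}\cup\{\text{eigenvalues of }q\},$$ $$\tilde b(\lambda_0)=-\frac{\psi_2^-}{\psi_1^+},$$ $$\tilde Q_c(\lambda)=\frac{\lambda-\lambda_0^*}{\lambda-\lambda_0}\,Q_c(\lambda)\quad\text{for }\lambda\in\mathbb{R},$$ $$\tilde Q_d(\lambda_i)=\frac{\lambda_i-\lambda_0^*}{\lambda_i-\lambda_0}\,Q_d(\lambda_i)\quad\text{for }\lambda_i\in\{\text{eigenvalues of }q\},$$ $$\tilde Q_d(\lambda_0)=-\frac{\lambda_0-\lambda_0^*}{a(\lambda_0)}\cdot\frac{\psi_2^-}{\psi_1^+}.$$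
   Context: Notation: $j=\sqrt{-1}$, $x^*$ is the complex conjugate of $x$, $q_t=\partial q/\partial t$, $I$ is the $2\times2$ identity, $\mathbb{C}^+$ is the upper half complex plane. $q(t,z)$ is a complex-valued function of real variables, smooth enough that the expressions below make sense, and $|q(t,z)|$ is assumed to vanish sufficiently fast as $|t|\to\infty$. Linear system (Zakharov–Shabat Lax pair). For a spectral parameter $\lambda\in\mathbb{C}$, $$P(q,\lambda)=\begin{pmatrix}-j\lambda&q\\-q^*&j\lambda\end{pmatrix},\qquad M(q,\lambda)=\begin{pmatrix}2j\lambda^2-j|q|^2&-2\lambda q-jq_t\\2\lambda q^*-jq_t^*&-2j\lambda^2+j|q|^2\end{pmatrix}.$$ Canonical solutions and scattering functions (at fixed $z$, here $z=0$). For $\lambda\in\mathbb{C}^+$ or $\lambda\in\mathbb{R}$, let $\phi^{\mathrm N}(t;\lambda)$ and $\phi^{\mathrm P}(t;\lambda)$ be the solutions of $\partial_t\phi=P(q,\lambda)\phi$ with $$\phi^{\mathrm N}(t;\lambda)\sim\begin{pmatrix}1\\0\end{pmatrix}e^{-j\lambda t}\ (t\to-\infty),\qquad \phi^{\mathrm P}(t;\lambda)\sim\begin{pmatrix}0\\1\end{pmatrix}e^{j\lambda t}\ (t\to+\infty).$$ The scattering functions are $$a(\lambda)=\phi_1^{\mathrm N}\phi_2^{\mathrm P}-\phi_2^{\mathrm N}\phi_1^{\mathrm P}=\lim_{t\to+\infty}e^{j\lambda t}\phi_1^{\mathrm N}(t;\lambda),\qquad b(\lambda)=\lim_{t\to+\infty}e^{-j\lambda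 t}\phi_2^{\mathrm N}(t;\lambda),$$ where $a$ is considered for $\lambda\in\mathbb{C}^+\cup\mathbb{R}$, and $b$ for $\lambda\in\mathbb{R}$ and for $\lambda\in\mathbb{C}^+$ with $a(\lambda)=0$ (in the latter case $\phi^{\mathrm N}(t;\lambda)=b(\lambda)\phi^{\mathrm P}(t;\lambda)$). The same definitions with $\tilde q$ in place of $q$ give $\tilde a,\tilde b$. Spectrum. The eigenvalues of $q$ are the zeros $\lambda_i\in\mathbb{C}^+\setminus\mathbb{R}$ of $a$ (together with their conjugates $\lambda_i^*$; formulas are stated for the ones in $\mathbb{C}^+$). The continuous spectrum is $Q_c(\lambda)=b(\lambda)/a(\lambda)$ for $\lambda\in\mathbb{R}$, and the discrete spectral amplitudes are $Q_d(\lambda_i)=b(\lambda_i)/a'(\lambda_i)$ at the eigenvalues $\lambda_i\in\mathbb{C}^+$, where $a'=da/d\lambda$ (whenever these quotients are defined). *)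

(* Defs.v *)
From Stdlib Require Export Reals.
From Coquelicot Require Export Coquelicot.

Open Scope R_scope.
Open Scope C_scope.

Definition Cexp (x : C) : C :=
  (exp (Re x) * cos (Im x), exp (Re x) * sin (Im x))%R.

Definition mat2 : Type := @matrix C 2 2.

Definition mx2 (m00 m01 m10 m11 : C) : mat2 := [[m00, m01], [m10, m11]].

Definition entry (A : mat2) (k l : nat) : C := coeff_mat (RtoC 0) A k l.

Definition mulm (A B : mat2) : mat2 := @Mmult C_Ring 2 2 2 A B.

Definition subm (A B : mat2) : mat2 :=
  @Mplus C_AbelianGroup 2 2 A (@Mopp C_AbelianGroup 2 2 B).

Definition diag2 (x y : C) : mat2 := mx2 x 0 0 y.

Definition det2 (A : mat2) : C :=
  entry A 0 0 * entry A 1 1 - entry A 0 1 * entry A 1 0.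

(* Adjugate over determinant: the inverse of A as soon as det2 A <> 0. *)
Definition invm (A : mat2) : mat2 :=
  mx2 (entry A 1 1 / det2 A) (- entry A 0 1 / det2 A)
      (- entry A 1 0 / det2 A) (entry A 0 0 / det2 A).

Definition act (A : mat2) (v : C * C) : C * C :=
  (entry A 0 0 * fst v + entry A 0 1 * snd v,
   entry A 1 0 * fst v + entry A 1 1 * snd v).

(* The Zakharov-Shabat pair at a point (t, z): q stands for the value q(t, z)
   and qt for the value of the partial derivative of q with respect to t. *)
Definition laxP (q lam : C) : mat2 :=
  mx2 (- Ci * lam) q
      (- Cconj q) (Ci * lam).

Definition laxM (q qt lam : C) : mat2 :=
  mx2 (2 * Ci * lam ^ 2 - Ci * RtoC (Cmod q ^ 2)) (- 2 * lam * q - Ci * qt)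
      (2 * lam * Cconj q - Ci * Cconj qt) (- 2 * Ci * lam ^ 2 + Ci * RtoC (Cmod q ^ 2)).

Definition solves_t (q : R -> C) (lam : C) (phi : R -> C * C) : Prop :=
  forall t : R, is_derive phi t (act (laxP (q t) lam) (phi t)).

(* The existence of the t-derivative of q, which enters laxM, is part of
   satisfying the z-equation. *)
Definition solves_lax (q : R -> R -> C) (lam : C) (v : R -> R -> C * C) : Prop :=
  (forall z : R, solves_t (fun t => q t z) lam (fun t => v t z)) /\
  (forall t z : R, exists qt : C,
     is_derive (fun s => q s z) t qt /\
     is_derive (fun y => v t y) z (act (laxM (q t z) qt lam) (v t z))).

(* The regularity that makes laxP and laxM continuous in (t, z). *)
Definition smooth_potential (q : R -> R -> C) : Prop :=
  (forall p : R * R, continuous (fun x : R * R => q (fst x) (snd x)) p) /\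
  exists qt : R -> R -> C,
    (forall t z : R, is_derive (fun s => q s z) t (qt t z)) /\
    (forall p : R * R, continuous (fun x : R * R => qt (fst x) (snd x)) p).

Definition abs_integrable (q : R -> C) : Prop :=
  ex_RInt_gen (fun t => Cmod (q t)) (Rbar_locally m_infty) (Rbar_locally p_infty).

Definition tends (F : (R -> Prop) -> Prop) (f : R -> C) (l : C) : Prop :=
  filterlim f F (locally l).

(* phi(t) ~ v e^(c t) is read as: e^(- c t) phi(t) tends to the vector v. *)
Definition jostN (q : R -> C) (lam : C) (phi : R -> C * C) : Prop :=
  solves_t q lam phi /\
  tends (Rbar_locally m_infty) (fun t => Cexp (Ci * lam * t) * fst (phi t)) 1 /\
  tends (Rbar_locally m_infty) (fun t => Cexp (Ci * lam * t) * snd (phi t)) 0.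

Definition jostP (q : R -> C) (lam : C) (phi : R -> C * C) : Prop :=
  solves_t q lam phi /\
  tends (Rbar_locally p_infty) (fun t => Cexp (- Ci * lam * t) * fst (phi t)) 0 /\
  tends (Rbar_locally p_infty) (fun t => Cexp (- Ci * lam * t) * snd (phi t)) 1.

Definition is_a (q : R -> C) (lam alpha : C) : Prop :=
  exists phiN phiP : R -> C * C,
    jostN q lam phiN /\ jostP q lam phiP /\
    (forall t : R,
       fst (phiN t) * snd (phiP t) - snd (phiN t) * fst (phiP t) = alpha) /\
    tends (Rbar_locally p_infty) (fun t => Cexp (Ci * lam * t) * fst (phiN t)) alpha.

Definition is_b (q : R -> C) (lam beta : C) : Prop :=
  exists phiN phiP : R -> C * C,
    jostN q lam phiN /\ jostP q lam phiP /\
    tends (Rbar_locally p_infty) (fun t => Cexp (- Ci * lam * t) * snd (phiN t)) beta /\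
    ((0 < Im lam)%R ->
     forall t : R, phiN t = (beta * fst (phiP t), beta * snd (phiP t))).

Definition eigenvalue (a : C -> C) (lam : C) : Prop :=
  (0 < Im lam)%R /\ a lam = 0.

Definition in_discrete_spectrum (a : C -> C) (lam : C) : Prop :=
  eigenvalue a lam \/ eigenvalue a (Cconj lam).

(* The values of a below the real axis, and those of b elsewhere than on the
   real axis and at the eigenvalues, are irrelevant. *)
Definition scattering_functions (q : R -> C) (a b : C -> C) : Prop :=
  (forall lam : C, (0 <= Im lam)%R -> is_a q lam (a lam)) /\
  (forall lam : C, Im lam = 0%R \/ eigenvalue a lam -> is_b q lam (b lam)).

(* The quotients b/a and b/a' as relations: they hold only where the quotient
   is defined. *)
Definition is_Qc (a b : C -> C) (lam Q : C) : Prop :=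
  a lam <> 0 /\ Q = b lam / a lam.

Definition is_Qd (a b : C -> C) (lam Q : C) : Prop :=
  exists da : C,
    @is_derive C_AbsRing C_NormedModule a lam da /\ da <> 0 /\ Q = b lam / da.

Definition Psi (psi : C * C) : mat2 :=
  mx2 (fst psi) (Cconj (snd psi))
      (snd psi) (- Cconj (fst psi)).

Definition Sigma (lam0 : C) (psi : C * C) : mat2 :=
  mulm (mulm (Psi psi) (diag2 lam0 (Cconj lam0))) (invm (Psi psi)).

Definition darboux (lam0 : C) (psi : R -> R -> C * C) (q : R -> R -> C)
    (t z : R) : C :=
  q t z - 2 * Ci * (lam0 - Cconj lam0) *
    (Cconj (snd (psi t z)) * fst (psi t z) /
     RtoC (Cmod (fst (psi t z)) ^ 2 + Cmod (snd (psi t z)) ^ 2)).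

(* Main.v *)
Require Import Defs.
From Stdlib Require Import Lra Psatz FunctionalExtensionality.

(** Algebra. Write p for the value of psi, p^* for its conjugate transpose and
    n for |p_1|^2 + |p_2|^2. Then
    Sigma = conj lam0 + (lam0 - conj lam0) p p^* / n, so mu - Sigma acts on v as
    (mu - conj lam0) v minus a multiple of p; this is [dressed]. Once psi
    vanishes nowhere, part (a) is a pair of rational identities,
    [dressing_t] and [dressing_z], in p, v, q, q_t and their conjugates. That
    psi vanishes nowhere is uniqueness for the two linear equations, first
    along t and then along z ([lax_solution_neq0]).

    Scattering. The Jost solutions of the new potential are the old ones
    multiplied by (lam - Sigma) / (lam - conj lam0). As psi_1 grows at
    t = +oo and psi_2 at t = -oo, the projector p p^* / n tends to diag(1, 0)
    and to diag(0, 1) respectively, so Sigma becomes diagonal at both ends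
    ([projector_right], [projector_left]). The chosen normalization then keeps
    both Jost conditions, multiplies a by
    (lam - lam0) / (lam - conj lam0), which is also the determinant of the
    multiplier, and keeps b. At lam0 the multiplier is the projector onto the
    orthogonal complement of p, the dressed solution only remembers the
    Wronskian with psi, and the two constant Wronskians are psi2m and
    -psi1p; hence b(lam0) ([dressed_is_b_lam0]).

    Analysis. Every asymptotic estimate comes from one energy identity. In the gauge
    x = exp(j lam t) phi the potential enters through a skew-Hermitian matrix
    and drops out of the derivative of |x|^2, which is
    - 4 Im(lam) |x_2|^2 ([gauged_energy]). For Im(lam) >= 0 the energy thus
    decreases: Jost solutions at -oo are unique and bounded by 1, and for
    Im(lam) > 0 convergence of x_1 forces x_2 to tend to 0
    ([gauged_recessive]). Applied to the difference of two Jost solutions for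
    different lam, the same computation bounds |a(lam) - a(mu)|
    ([is_a_lipschitz]).

    The amplitudes at the eigenvalues follow because each time a-tilde is a
    product u w with w(z) = 0, w differentiable at z and u continuous there, and
    then its derivative is u(z) w'(z) ([is_derive_mult_at_zero]). At lam0
    the factor u contains a, and only its continuity is at hand. *)

(** * Derivatives of complex-valued functions of a real variable *)

Lemma is_derive_pair {U V : NormedModule R_AbsRing} (f : R -> U) (g : R -> V)
    (t : R) (l : U) (m : V) :
  is_derive f t l -> is_derive g t m ->
  @is_derive R_AbsRing (prod_NormedModule R_AbsRing U V)
    (fun s => (f s, g s)) t (l, m).
Proof.
  intros F G.
  apply (filterdiff_comp'_2 (W := prod_NormedModule R_AbsRing U V) f g
           (fun x y => (x, y)) t (fun y => scal y l) (fun y => scal y m)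
           (fun x y => (x, y)) F G).
  apply filterdiff_linear, is_linear_prod;
    [apply is_linear_fst | apply is_linear_snd].
Qed.

Lemma is_derive_fst {U V : NormedModule R_AbsRing} (f : R -> U * V)
    (t : R) (l : U * V) :
  @is_derive R_AbsRing (prod_NormedModule R_AbsRing U V) f t l ->
  is_derive (fun s => fst (f s)) t (fst l).
Proof.
  intros F.
  apply (filterdiff_comp' (V := prod_NormedModule R_AbsRing U V) f fst t
           (fun y => scal y l) fst F).
  apply filterdiff_linear, is_linear_fst.
Qed.

Lemma is_derive_snd {U V : NormedModule R_AbsRing} (f : R -> U * V)
    (t : R) (l : U * V) :
  @is_derive R_AbsRing (prod_NormedModule R_AbsRing U V) f t l ->
  is_derive (fun s => snd (f s)) t (snd l).
Proof.
  intros F.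
  apply (filterdiff_comp' (V := prod_NormedModule R_AbsRing U V) f snd t
           (fun y => scal y l) snd F).
  apply filterdiff_linear, is_linear_snd.
Qed.

Lemma is_derive_C2 (v : R -> C * C) (t : R) (l : C * C) :
  is_derive v t l ->
  is_derive (fun s => fst (v s)) t (fst l) /\ is_derive (fun s => snd (v s)) t (snd l).
Proof. intros V. split; [exact (is_derive_fst _ _ _ V) | exact (is_derive_snd _ _ _ V)]. Qed.

Lemma is_derive_eq {V : NormedModule R_AbsRing} (f : R -> V) (t : R) (l m : V) :
  is_derive f t l -> l = m -> is_derive f t m.
Proof. now intros F <-. Qed.

Lemma is_derive_Ceq (f : R -> C) (t : R) (l m : C) :
  is_derive f t l -> l = m -> is_derive f t m.
Proof. now intros F <-. Qed.

Lemma is_derive_Cpair (f : R -> C) (t : R) (l : C) :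
  is_derive (fun s => fst (f s)) t (fst l) ->
  is_derive (fun s => snd (f s)) t (snd l) -> is_derive f t l.
Proof.
  intros F G.
  apply (is_derive_ext (fun s => (fst (f s), snd (f s)))).
  { intros s. now destruct (f s). }
  replace l with (fst l, snd l) by now destruct l.
  now apply is_derive_pair.
Qed.

Lemma is_derive_Cconst (c : C) (t : R) : is_derive (fun _ : R => c) t (RtoC 0).
Proof. exact (is_derive_const (V := C_R_NormedModule) c t). Qed.

Lemma is_derive_Cplus (f g : R -> C) (t : R) (l m : C) :
  is_derive f t l -> is_derive g t m -> is_derive (fun s => f s + g s) t (l + m).
Proof. exact (is_derive_plus (V := C_R_NormedModule) f g t l m). Qed.

Lemma is_derive_Copp (f : R -> C) (t : R) (l : C) :
  is_derive f t l -> is_derive (fun s => - f s) t (- l).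
Proof. exact (is_derive_opp (V := C_R_NormedModule) f t l). Qed.

Lemma is_derive_Cminus (f g : R -> C) (t : R) (l m : C) :
  is_derive f t l -> is_derive g t m -> is_derive (fun s => f s - g s) t (l - m).
Proof. intros F G. now apply is_derive_Cplus, is_derive_Copp. Qed.

Lemma is_derive_Cmult (f g : R -> C) (t : R) (l m : C) :
  is_derive f t l -> is_derive g t m ->
  is_derive (fun s => f s * g s) t (l * g t + f t * m).
Proof.
  intros F G.
  pose proof (is_derive_fst _ _ _ F) as F1. pose proof (is_derive_snd _ _ _ F) as F2.
  pose proof (is_derive_fst _ _ _ G) as G1. pose proof (is_derive_snd _ _ _ G) as G2.
  apply is_derive_Cpair; simpl.
  - eapply is_derive_eq.
    + exact (is_derive_minus _ _ _ _ _ (Derive.is_derive_mult _ _ _ _ _ F1 G1)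
               (Derive.is_derive_mult _ _ _ _ _ F2 G2)).
    + unfold minus, plus, opp; simpl. ring.
  - eapply is_derive_eq.
    + exact (is_derive_plus _ _ _ _ _ (Derive.is_derive_mult _ _ _ _ _ F1 G2)
               (Derive.is_derive_mult _ _ _ _ _ F2 G1)).
    + unfold plus; simpl. ring.
Qed.

Lemma is_derive_Cconj (f : R -> C) (t : R) (l : C) :
  is_derive f t l -> is_derive (fun s => Cconj (f s)) t (Cconj l).
Proof.
  intros F. apply is_derive_Cpair; simpl.
  - exact (is_derive_fst _ _ _ F).
  - exact (is_derive_opp _ _ _ (is_derive_snd _ _ _ F)).
Qed.

Lemma is_derive_Cinv (f : R -> C) (t : R) (l : C) :
  is_derive f t l -> f t <> 0 -> is_derive (fun s => / f s) t (- l / (f t * f t)).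
Proof.
  intros F N.
  pose proof (is_derive_fst _ _ _ F) as F1. pose proof (is_derive_snd _ _ _ F) as F2.
  assert (D : is_derive (fun s => fst (f s) ^ 2 + snd (f s) ^ 2)%R t
            (2 * fst l * fst (f t) + 2 * snd l * snd (f t))%R).
  { eapply is_derive_eq.
    - exact (is_derive_plus _ _ _ _ _ (is_derive_pow _ 2 _ _ F1) (is_derive_pow _ 2 _ _ F2)).
    - unfold plus; simpl. ring. }
  assert (P : (fst (f t) ^ 2 + snd (f t) ^ 2 <> 0)%R).
  { intros H. apply N. destruct (f t) as [x y]; simpl in *.
    assert (x = 0%R) by nra. assert (y = 0%R) by nra. now subst. }
  assert (P' : ((fst (f t) * fst (f t) - snd (f t) * snd (f t)) ^ 2 +
                (fst (f t) * snd (f t) + snd (f t) * fst (f t)) ^ 2 <> 0)%R).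
  { replace (_ + _)%R with ((fst (f t) ^ 2 + snd (f t) ^ 2) ^ 2)%R by ring.
    now apply pow_nonzero. }
  apply is_derive_Cpair; simpl.
  - eapply is_derive_eq.
    + exact (is_derive_div _ _ _ _ _ F1 D P).
    + simpl in *. field. repeat split; simpl; lra.
  - eapply is_derive_eq.
    + exact (is_derive_div _ _ _ _ _ (is_derive_opp _ _ _ F2) D P).
    + unfold opp; simpl in *. field. repeat split; simpl; lra.
Qed.

Lemma is_derive_C_unique (f : R -> C) (t : R) (l m : C) :
  is_derive f t l -> is_derive f t m -> l = m.
Proof.
  intros F G.
  rewrite (surjective_pairing l), (surjective_pairing m). f_equal.
  - transitivity (Derive (fun s => fst (f s)) t); [symmetry |];
      apply is_derive_unique; [exact (is_derive_fst _ _ _ F) | exact (is_derive_fst _ _ _ G)].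
  - transitivity (Derive (fun s => snd (f s)) t); [symmetry |];
      apply is_derive_unique; [exact (is_derive_snd _ _ _ F) | exact (is_derive_snd _ _ _ G)].
Qed.

Lemma Cmod_sqr (c : C) : (Cmod c ^ 2 = fst c ^ 2 + snd c ^ 2)%R.
Proof. unfold Cmod. rewrite pow2_sqrt; [reflexivity | nra]. Qed.

Lemma is_derive_Cmod_sqr (f : R -> C) (t : R) (l : C) :
  is_derive f t l ->
  is_derive (fun s => Cmod (f s) ^ 2)%R t (2 * Re (Cconj (f t) * l))%R.
Proof.
  intros F.
  apply (is_derive_ext (fun s => fst (f s) ^ 2 + snd (f s) ^ 2)%R).
  { intros s. symmetry. apply Cmod_sqr. }
  eapply is_derive_eq.
  - exact (is_derive_plus _ _ _ _ _ (is_derive_pow _ 2 _ _ (is_derive_fst _ _ _ F))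
      (is_derive_pow _ 2 _ _ (is_derive_snd _ _ _ F))).
  - unfold plus; simpl. ring.
Qed.

(** * Limits of complex-valued functions *)

Local Notation lim F f l := (filterlim f F (@locally C_UniformSpace (l : C))).

Section Tends.
Context {T : Type} {F : (T -> Prop) -> Prop} {FF : Filter F}.

Lemma tends_const (c : C) : lim F (fun _ => c) c.
Proof. apply filterlim_const. Qed.

Lemma tends_plus (f g : T -> C) (l m : C) :
  lim F f l -> lim F g m -> lim F (fun t => f t + g t) (l + m).
Proof.
  intros Hf Hg.
  eapply filterlim_comp_2;
    [exact Hf | exact Hg | exact (filterlim_plus (V := C_R_NormedModule) l m)].
Qed.

Lemma tends_opp (f : T -> C) (l : C) :
  lim F f l -> lim F (fun t => - f t) (- l).
Proof.
  intros Hf.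
  exact (filterlim_comp _ _ _ _ _ _ _ _ Hf (filterlim_opp (V := C_R_NormedModule) l)).
Qed.

Lemma tends_minus (f g : T -> C) (l m : C) :
  lim F f l -> lim F g m -> lim F (fun t => f t - g t) (l - m).
Proof. intros Hf Hg. now apply tends_plus, tends_opp. Qed.

(** The uniform structure on [C] is the product one on [R * R], which is
    equivalent to that of the modulus without being equal to it. *)
Lemma tends_iff (f : T -> C) (l : C) :
  lim F f l <-> forall eps : posreal, F (fun t => Cmod (f t - l) < eps)%R.
Proof.
  split.
  - intros H eps. apply (H (fun x => Cmod (x - l) < eps)%R).
    apply (proj2 (locally_C l _)). now exists eps.
  - intros H P HP. apply (proj1 (locally_C l _)) in HP. destruct HP as [eps HP].
    refine (filter_imp (fun t => Cmod (f t - l) < eps)%R _ _ (H eps)).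
    intros t Ht. apply HP, Ht.
Qed.

Lemma tends_mult (f g : T -> C) (l m : C) :
  lim F f l -> lim F g m -> lim F (fun t => f t * g t) (l * m).
Proof.
  assert (E : forall (h : T -> C) (k : C), lim F h k <->
     filterlim h F (@locally (AbsRing_UniformSpace C_AbsRing) k)).
  { intros h k. split; intros H P HP; apply H, locally_C, HP. }
  intros Hf Hg. apply E. apply E in Hf, Hg.
  eapply filterlim_comp_2;
    [exact Hf | exact Hg | exact (filterlim_mult (K := C_AbsRing) l m)].
Qed.

Lemma tends_conj (f : T -> C) (l : C) :
  lim F f l -> lim F (fun t => Cconj (f t)) (Cconj l).
Proof.
  intros H. apply tends_iff. intros eps.
  generalize (proj1 (tends_iff _ _) H eps). apply filter_imp. intros t Ht.
  now rewrite <- Cminus_conj, Cmod_conj.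
Qed.

Lemma tends_mod (f : T -> C) (l : C) :
  lim F f l -> filterlim (fun t => Cmod (f t)) F (locally (Cmod l)).
Proof.
  intros H.
  exact (filterlim_comp _ _ _ _ _ _ _ _ H (filterlim_norm (V := C_NormedModule) l)).
Qed.

Lemma tends_bounded_mult (f g : T -> C) (M : R) :
  F (fun t => Cmod (g t) <= M)%R -> lim F f 0 -> lim F (fun t => f t * g t) 0.
Proof.
  intros Hg Hf. apply tends_iff. intros eps.
  assert (K : (0 < eps / (Rabs M + 1))%R).
  { apply Rdiv_lt_0_compat; [apply cond_pos | pose proof (Rabs_pos M); lra]. }
  generalize (filter_and _ _ Hg (proj1 (tends_iff _ _) Hf (mkposreal _ K))).
  apply filter_imp. simpl. intros t [Hgt Hft].
  replace (f t * g t - 0) with ((f t - 0) * g t) by ring.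
  rewrite Cmod_mult.
  pose proof (Rabs_pos M). pose proof (Rle_abs M).
  pose proof (Cmod_ge_0 (f t - 0)). pose proof (Cmod_ge_0 (g t)).
  apply Rle_lt_trans with (Cmod (f t - 0) * (Rabs M + 1))%R; [nra |].
  apply Rmult_lt_reg_r with (/ (Rabs M + 1))%R; [apply Rinv_0_lt_compat; lra |].
  rewrite Rmult_assoc, Rinv_r, Rmult_1_r by lra. exact Hft.
Qed.

Lemma tends_eq (f g : T -> C) (l m : C) :
  (forall t, f t = g t) -> l = m -> lim F f l -> lim F g m.
Proof. intros E <-. apply filterlim_ext, E. Qed.

Lemma tends_inv (f : T -> C) (l : C) :
  l <> 0 -> lim F f l -> lim F (fun t => / f t) (/ l).
Proof.
  intros Hl H.
  pose proof (proj1 (Cmod_gt_0 l) Hl) as Pl.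
  assert (B : F (fun t => Cmod (f t - l) < Cmod l / 2)%R).
  { exact (proj1 (tends_iff _ _) H (mkposreal (Cmod l / 2) ltac:(lra))). }
  assert (Low : forall t, (Cmod (f t - l) < Cmod l / 2)%R -> (Cmod l / 2 <= Cmod (f t))%R).
  { intros t Ht. pose proof (Cmod_triangle (f t) (- (f t - l))) as Tri.
    replace (f t + - (f t - l)) with l in Tri by ring. rewrite Cmod_opp in Tri. lra. }
  assert (Nz : forall t, (Cmod l / 2 <= Cmod (f t))%R -> f t <> 0).
  { intros t Ht E. rewrite E, Cmod_0 in Ht. lra. }
  assert (D : lim F (fun t => (- (f t - l)) * (/ f t * / l)) 0).
  { apply tends_bounded_mult with (/ (Cmod l / 2) * / Cmod l)%R.
    - revert B. apply filter_imp. intros t Ht. apply Low in Ht.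
      rewrite Cmod_mult, !Cmod_inv by auto.
      apply Rmult_le_compat_r; [left; now apply Rinv_0_lt_compat |].
      apply Rinv_le_contravar; lra.
    - replace (RtoC 0) with (- (l - l)) by ring.
      apply tends_opp, tends_minus; [exact H | apply tends_const]. }
  assert (E : lim F (fun t => (- (f t - l)) * (/ f t * / l) + / l) (/ l)).
  { apply (tends_eq _ _ _ _ (fun _ => eq_refl) (Cplus_0_l (/ l))).
    apply tends_plus; [exact D | apply tends_const]. }
  revert E. apply filterlim_ext_loc. revert B. apply filter_imp.
  intros t Ht. apply Low, Nz in Ht. field. now split.
Qed.

End Tends.

Lemma tends_unique {T : Type} {F : (T -> Prop) -> Prop} {FF : ProperFilter F}
    (f : T -> C) (l m : C) :
  lim F f l -> lim F f m -> l = m.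
Proof. intros H K. exact (filterlim_locally_unique (V := C_R_NormedModule) f l m H K). Qed.

Lemma continuous_C_iff (u : C -> C) (z : C) :
  continuous u z <->
  forall eps : posreal, exists delta : posreal, forall y,
    (Cmod (y - z) < delta)%R -> (Cmod (u y - u z) < eps)%R.
Proof.
  split.
  - intros H eps. exact (proj1 (locally_C _ _) (proj1 (tends_iff _ _) H eps)).
  - intros H. apply tends_iff. intros eps. apply locally_C. exact (H eps).
Qed.

(** * Monotonicity and linear differential equations *)

Definition sqnorm (p : C * C) : R := (Cmod (fst p) ^ 2 + Cmod (snd p) ^ 2)%R.

Lemma sqnorm_ge0 (p : C * C) : (0 <= sqnorm p)%R.
Proof. unfold sqnorm. nra. Qed.

Lemma sqnorm_eq0 (p : C * C) : sqnorm p = 0%R -> p = (RtoC 0, RtoC 0).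
Proof.
  unfold sqnorm. destruct p as [x y]; simpl. intros H.
  pose proof (Cmod_ge_0 x). pose proof (Cmod_ge_0 y).
  f_equal; apply Cmod_eq_0; nra.
Qed.

Lemma sqnorm_C (p : C * C) :
  RtoC (sqnorm p) = fst p * Cconj (fst p) + snd p * Cconj (snd p).
Proof. unfold sqnorm. now rewrite RtoC_plus, !Cmod2_conj. Qed.

Lemma sqnorm_C_neq0 (p : C * C) :
  p <> (RtoC 0, RtoC 0) -> fst p * Cconj (fst p) + snd p * Cconj (snd p) <> 0.
Proof.
  intros N H. rewrite <- sqnorm_C in H. apply N, sqnorm_eq0. now apply RtoC_inj.
Qed.

Lemma is_derive_sqnorm (v : R -> C * C) (t : R) (l m : C) :
  is_derive (fun s => fst (v s)) t l -> is_derive (fun s => snd (v s)) t m ->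
  is_derive (fun s => sqnorm (v s)) t
    (2 * (Re (Cconj (fst (v t)) * l) + Re (Cconj (snd (v t)) * m)))%R.
Proof.
  intros F G. eapply is_derive_eq.
  - exact (is_derive_plus _ _ _ _ _ (is_derive_Cmod_sqr _ _ _ F)
      (is_derive_Cmod_sqr _ _ _ G)).
  - unfold plus; simpl. ring.
Qed.

Lemma mean_value (f df : R -> R) (s t : R) :
  (s < t)%R -> (forall x, (s <= x <= t)%R -> is_derive f x (df x)) ->
  exists c, (s <= c <= t)%R /\ (f t - f s = df c * (t - s))%R.
Proof.
  intros L D. destruct (MVT_cor2 f df s t L) as [c [E I]].
  - intros c I. apply is_derive_Reals, D, I.
  - exists c. split; [lra | exact E].
Qed.

Lemma nonincreasing (f df : R -> R) (s t : R) :
  (s <= t)%R -> (forall x, (s <= x <= t)%R -> is_derive f x (df x)) ->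
  (forall x, (s <= x <= t)%R -> (df x <= 0)%R) -> (f t <= f s)%R.
Proof.
  intros [L | ->] D N; [| lra].
  destruct (mean_value f df s t L D) as [c [I E]]. pose proof (N c I). nra.
Qed.

Lemma le_limit_m_infty (f : R -> R) (l : R) :
  (forall s t, (s <= t)%R -> (f t <= f s)%R) ->
  filterlim f (Rbar_locally m_infty) (locally l) -> forall t, (f t <= l)%R.
Proof.
  intros D H t.
  apply (filterlim_le (F := Rbar_locally m_infty) (fun _ => f t) f (f t) l).
  - exists t. intros x Hx. apply D. lra.
  - apply filterlim_const.
  - exact H.
Qed.

Lemma decreasing_limit_p_infty (f : R -> R) :
  (forall s t, (s <= t)%R -> (f t <= f s)%R) -> (forall t, (0 <= f t)%R) ->
  exists l : R, filterlim f (Rbar_locally p_infty) (locally l).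
Proof.
  intros D P.
  destruct (completeness (fun y => exists t, y = (- f t)%R)) as [m [U L]].
  { exists 0%R. intros y [t ->]. pose proof (P t). lra. }
  { exists (- f 0)%R. now exists 0%R. }
  exists (- m)%R. apply filterlim_locally. intros eps.
  assert (H : exists T, (- f T > m - eps)%R).
  { destruct (Classical_Prop.classic (exists T, (- f T > m - eps)%R)) as [H | H]; [exact H |].
    assert (m <= m - eps)%R; [| pose proof (cond_pos eps); lra].
    apply L. intros y [t ->]. apply Rnot_gt_le. intros G. apply H. now exists t. }
  destruct H as [T HT]. exists T. intros t Ht.
  pose proof (U (- f t)%R (ex_intro _ t eq_refl)). pose proof (D T t ltac:(lra)).
  change (Rabs (f t - - m) < eps)%R. apply Rabs_def1; lra.
Qed.

(** Both [f exp(- K x)] and [- f exp(K x)] decrease, so a zero at either end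
    of the interval spreads to the other one. *)
Lemma gronwall_zero (f df : R -> R) (K a b : R) :
  (a <= b)%R -> (forall x, (a <= x <= b)%R -> is_derive f x (df x)) ->
  (forall x, (0 <= f x)%R) ->
  (forall x, (a <= x <= b)%R -> (Rabs (df x) <= K * f x)%R) ->
  f a = 0%R \/ f b = 0%R -> f a = 0%R /\ f b = 0%R.
Proof.
  intros L D P B Z.
  assert (E : forall k x, is_derive (fun s => exp (k * s)) x (k * exp (k * x))%R).
  { intros k x. auto_derive; [exact I | ring]. }
  assert (U : (f b * exp (- K * b) <= f a * exp (- K * a))%R).
  { apply (nonincreasing (fun x => f x * exp (- K * x))%R
      (fun x => df x * exp (- K * x) + f x * (- K * exp (- K * x)))%R a b L).
    - intros x Hx. exact (Derive.is_derive_mult _ _ _ _ _ (D x Hx) (E (- K)%R x)).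
    - intros x Hx. pose proof (B x Hx). pose proof (Rle_abs (df x)).
      pose proof (exp_pos (- K * x)). nra. }
  assert (V : (- f b * exp (K * b) <= - f a * exp (K * a))%R).
  { apply (nonincreasing (fun x => - f x * exp (K * x))%R
      (fun x => - df x * exp (K * x) + - f x * (K * exp (K * x)))%R a b L).
    - intros x Hx.
      exact (Derive.is_derive_mult _ _ _ _ _ (is_derive_opp _ _ _ (D x Hx)) (E K x)).
    - intros x Hx. pose proof (B x Hx). pose proof (Rabs_maj2 (df x)).
      pose proof (exp_pos (K * x)). nra. }
  pose proof (P a). pose proof (P b).
  pose proof (exp_pos (- K * b)). pose proof (exp_pos (- K * a)).
  pose proof (exp_pos (K * b)). pose proof (exp_pos (K * a)).
  destruct Z as [Z | Z]; rewrite Z in *; split; nra.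
Qed.

Lemma Re_le_Cmod (c : C) : (Rabs (Re c) <= Cmod c)%R.
Proof. apply Rle_trans with (2 := Rmax_Cmod c). apply Rmax_l. Qed.

Definition mat_size (A : mat2) : R :=
  (Cmod (entry A 0 0) + Cmod (entry A 0 1) + Cmod (entry A 1 0) + Cmod (entry A 1 1))%R.

Lemma linear_growth (A : mat2) (v : C * C) :
  (Rabs (2 * (Re (Cconj (fst v) * fst (act A v)) + Re (Cconj (snd v) * snd (act A v))))
     <= 2 * mat_size A * sqnorm v)%R.
Proof.
  assert (T : forall w x y z u : C, (Rabs (Re (Cconj w * (x * y + z * u))) <=
     Cmod w * (Cmod x * Cmod y + Cmod z * Cmod u))%R).
  { intros. eapply Rle_trans; [apply Re_le_Cmod |].
    rewrite Cmod_mult, Cmod_conj, <- (Cmod_mult x), <- (Cmod_mult z).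
    apply Rmult_le_compat_l; [apply Cmod_ge_0 | apply Cmod_triangle]. }
  rewrite Rabs_mult, (Rabs_right 2) by lra.
  rewrite Rmult_assoc. apply Rmult_le_compat_l; [lra |].
  eapply Rle_trans; [apply Rabs_triang |].
  eapply Rle_trans; [apply Rplus_le_compat; apply T |].
  unfold mat_size, sqnorm.
  set (a := Cmod (entry A 0 0)). set (b := Cmod (entry A 0 1)).
  set (c := Cmod (entry A 1 0)). set (d := Cmod (entry A 1 1)).
  set (x := Cmod (fst v)). set (y := Cmod (snd v)).
  assert (0 <= a)%R by apply Cmod_ge_0. assert (0 <= b)%R by apply Cmod_ge_0.
  assert (0 <= c)%R by apply Cmod_ge_0. assert (0 <= d)%R by apply Cmod_ge_0.
  assert (x * y <= x ^ 2 + y ^ 2)%R by nra.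
  assert (x * x <= x ^ 2 + y ^ 2)%R by nra.
  assert (y * y <= x ^ 2 + y ^ 2)%R by nra.
  nra.
Qed.

(** Uniqueness of the zero solution, in both directions: on a compact interval
    the continuous coefficients are bounded, and the squared norm then
    satisfies the hypotheses of [gronwall_zero]. *)
Lemma linear_ode_zero (A : R -> mat2) (v : R -> C * C) (a b : R) :
  (forall s, is_derive v s (act (A s) (v s))) ->
  (forall s k l, continuous (fun s => entry (A s) k l) s) ->
  v a = (RtoC 0, RtoC 0) -> v b = (RtoC 0, RtoC 0).
Proof.
  intros D Ct Z.
  assert (Cz : forall s, continuous (fun s => mat_size (A s)) s).
  { intros s. unfold mat_size.
    assert (M : forall k l, continuous (fun s => Cmod (entry (A s) k l)) s)
      by (intros k l; apply tends_mod, Ct).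
    repeat first [apply (continuous_plus (V := R_NormedModule)) | apply M]. }
  assert (B : forall x y, exists K, forall s, (x <= s <= y)%R -> (mat_size (A s) <= K)%R).
  { intros x y.
    destruct (bounded_continuity (fun s => mat_size (A s)) x y) as [K HK].
    { intros s _. apply Cz. }
    exists K. intros s Hs. left. eapply Rle_lt_trans; [apply Rle_abs | exact (HK s Hs)]. }
  assert (Dn : forall s, is_derive (fun s => sqnorm (v s)) s
     (2 * (Re (Cconj (fst (v s)) * fst (act (A s) (v s))) +
           Re (Cconj (snd (v s)) * snd (act (A s) (v s)))))%R).
  { intros s. apply is_derive_sqnorm;
      [exact (is_derive_fst _ _ _ (D s)) | exact (is_derive_snd _ _ _ (D s))]. }
  assert (G : forall x y, (x <= y)%R -> sqnorm (v x) = 0%R \/ sqnorm (v y) = 0%R ->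
      sqnorm (v x) = 0%R /\ sqnorm (v y) = 0%R).
  { intros x y L O. destruct (B x y) as [K HK].
    refine (gronwall_zero _ _ (2 * K) x y L (fun s _ => Dn s) (fun s => sqnorm_ge0 (v s)) _ O).
    intros s Hs. eapply Rle_trans; [apply linear_growth |].
    pose proof (HK s Hs). pose proof (sqnorm_ge0 (v s)). nra. }
  assert (Za : sqnorm (v a) = 0%R).
  { rewrite Z. unfold sqnorm; simpl. rewrite Cmod_0. ring. }
  apply sqnorm_eq0. destruct (Rle_dec a b) as [L | L].
  - apply (G a b L). now left.
  - apply (G b a); [lra | now right].
Qed.

(** * The Zakharov-Shabat equation and its energy identity *)

Lemma Cexp_add (x y : C) : Cexp (x + y) = Cexp x * Cexp y.
Proof.
  unfold Cexp, Cmult, Cplus, Re, Im; simpl.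
  rewrite exp_plus, cos_plus, sin_plus. f_equal; ring.
Qed.

Lemma Cexp_0 : Cexp 0 = 1.
Proof.
  unfold Cexp, Re, Im, RtoC; simpl. rewrite exp_0, cos_0, sin_0. f_equal; ring.
Qed.

Lemma Cexp_inv (x y : C) : x + y = 0 -> Cexp x * Cexp y = 1.
Proof. intros H. now rewrite <- Cexp_add, H, Cexp_0. Qed.

Lemma Cmod_Cexp (x : C) : Cmod (Cexp x) = exp (Re x).
Proof.
  unfold Cexp, Cmod; cbn [fst snd].
  replace (_ + _)%R with (exp (Re x) ^ 2 * (Rsqr (sin (Im x)) + Rsqr (cos (Im x))))%R
    by (unfold Rsqr; ring).
  rewrite sin2_cos2, Rmult_1_r. apply sqrt_pow2. left. apply exp_pos.
Qed.

Lemma Cexp_neq0 (x : C) : Cexp x <> 0.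
Proof.
  intros H. pose proof (exp_pos (Re x)) as P.
  rewrite <- Cmod_Cexp, H, Cmod_0 in P. lra.
Qed.

Lemma is_derive_Cexp (c : C) (t : R) :
  is_derive (fun s : R => Cexp (c * s)) t (c * Cexp (c * t)).
Proof.
  destruct c as [x y].
  apply is_derive_Cpair; unfold Cexp, Cmult, RtoC, Re, Im; simpl;
    auto_derive; try exact I; unfold Rminus; ring.
Qed.

Lemma Ci_sqr : Ci * Ci = -1.
Proof. unfold Ci, Cmult, Copp, RtoC; simpl. f_equal; ring. Qed.

Lemma Ci_conj : Cconj Ci = - Ci.
Proof. unfold Ci, Cconj, Copp; simpl. f_equal; ring. Qed.

Lemma act_mx2 (m00 m01 m10 m11 : C) (v : C * C) :
  act (mx2 m00 m01 m10 m11) v =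
    (m00 * fst v + m01 * snd v, m10 * fst v + m11 * snd v).
Proof. reflexivity. Qed.

Lemma solves_t_iff (q : R -> C) (lam : C) (phi : R -> C * C) :
  solves_t q lam phi <->
  forall t,
    is_derive (fun s => fst (phi s)) t (- Ci * lam * fst (phi t) + q t * snd (phi t)) /\
    is_derive (fun s => snd (phi s)) t
      (- Cconj (q t) * fst (phi t) + Ci * lam * snd (phi t)).
Proof.
  split; intros H t.
  - split; [exact (is_derive_fst _ _ _ (H t)) | exact (is_derive_snd _ _ _ (H t))].
  - destruct (H t) as [F G].
    apply (is_derive_ext (fun s => (fst (phi s), snd (phi s)))).
    { intros s. now destruct (phi s). }
    exact (is_derive_pair _ _ _ _ _ F G).
Qed.

Definition cscale (c : C) (v : C * C) : C * C := (c * fst v, c * snd v).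

(** Removing the factor [exp(- j lam t)] turns the Jost condition at minus
    infinity into convergence to a constant vector. *)
Definition gauge (lam : C) (phi : R -> C * C) (t : R) : C * C :=
  cscale (Cexp (Ci * lam * t)) (phi t).

(** The Zakharov-Shabat equation in the variable [gauge lam phi]. *)
Definition gauged (q : R -> C) (lam : C) (x : R -> C * C) : Prop :=
  forall t,
    is_derive (fun s => fst (x s)) t (q t * snd (x t)) /\
    is_derive (fun s => snd (x s)) t
      (- Cconj (q t) * fst (x t) + 2 * Ci * lam * snd (x t)).

Lemma gauge_gauged (q : R -> C) (lam : C) (phi : R -> C * C) :
  solves_t q lam phi -> gauged q lam (gauge lam phi).
Proof.
  intros H t. destruct (proj1 (solves_t_iff _ _ _) H t) as [F G].
  unfold gauge, cscale; cbn [fst snd].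
  split; (eapply is_derive_Ceq; [apply is_derive_Cmult; [apply is_derive_Cexp | eassumption] |]);
    cbv beta; ring.
Qed.

(** The contributions of [q] to the two components cancel, because the
    off-diagonal part of the matrix is skew-Hermitian; the remaining diagonal
    entry has real part - 2 Im(lam). *)
Lemma gauged_energy (q : R -> C) (lam : C) (x : R -> C * C) (t : R) :
  gauged q lam x ->
  is_derive (fun s => sqnorm (x s)) t (- 4 * Im lam * Cmod (snd (x t)) ^ 2)%R.
Proof.
  intros H. destruct (H t) as [F G].
  eapply is_derive_eq; [exact (is_derive_sqnorm x t _ _ F G) |].
  rewrite Cmod_sqr. destruct (x t) as [[x1 x1'] [x2 x2']], (q t), lam.
  unfold Re, Im, Cconj, Cmult, Cplus, Copp, Ci, RtoC; simpl. ring.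
Qed.

Lemma gauged_nonincreasing (q : R -> C) (lam : C) (x : R -> C * C) (s t : R) :
  (0 <= Im lam)%R -> gauged q lam x -> (s <= t)%R -> (sqnorm (x t) <= sqnorm (x s))%R.
Proof.
  intros P H L.
  apply (nonincreasing (fun u => sqnorm (x u))
    (fun u => - 4 * Im lam * Cmod (snd (x u)) ^ 2)%R s t L).
  - intros u _. now apply (gauged_energy q).
  - intros u _. pose proof (pow2_ge_0 (Cmod (snd (x u)))). nra.
Qed.

Lemma tends_Cmod_sqr {F : (R -> Prop) -> Prop} {FF : Filter F} (f : R -> C) (l : C) :
  tends F f l -> filterlim (fun t => Cmod (f t) ^ 2)%R F (locally (Cmod l ^ 2)%R).
Proof.
  intros H.
  assert (E : (Cmod l ^ 2 = mult (Cmod l) (Cmod l))%R) by (unfold mult; simpl; ring).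
  rewrite E.
  apply (filterlim_ext (fun t => mult (Cmod (f t)) (Cmod (f t)))).
  { intros t. unfold mult; simpl. ring. }
  eapply filterlim_comp_2;
    [exact (tends_mod _ _ H) | exact (tends_mod _ _ H)
    | exact (filterlim_mult (K := R_AbsRing) (Cmod l) (Cmod l))].
Qed.

Lemma tends_sqnorm {F : (R -> Prop) -> Prop} {FF : Filter F} (x : R -> C * C) (l m : C) :
  tends F (fun t => fst (x t)) l -> tends F (fun t => snd (x t)) m ->
  filterlim (fun t => sqnorm (x t)) F (locally (sqnorm (l, m))).
Proof.
  intros H K.
  eapply filterlim_comp_2;
    [exact (tends_Cmod_sqr _ _ H) | exact (tends_Cmod_sqr _ _ K)
    | exact (filterlim_plus (V := R_NormedModule) _ _)].
Qed.

Lemma gauged_le_limit (q : R -> C) (lam : C) (x : R -> C * C) (l m : C) :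
  (0 <= Im lam)%R -> gauged q lam x ->
  tends (Rbar_locally m_infty) (fun t => fst (x t)) l ->
  tends (Rbar_locally m_infty) (fun t => snd (x t)) m ->
  forall t, (sqnorm (x t) <= sqnorm (l, m))%R.
Proof.
  intros P H Hl Hm.
  apply le_limit_m_infty; [intros s t; now apply (gauged_nonincreasing q lam) |].
  now apply tends_sqnorm.
Qed.

(** The energy decreases to a limit, so [|x_2|^2], which is the energy minus
    [|x_1|^2], has a limit as well. Were that limit positive, the energy would
    decrease at least linearly and become negative. *)
Lemma gauged_recessive (q : R -> C) (lam : C) (x : R -> C * C) (l : C) :
  (0 < Im lam)%R -> gauged q lam x ->
  tends (Rbar_locally p_infty) (fun t => fst (x t)) l ->
  tends (Rbar_locally p_infty) (fun t => snd (x t)) 0.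
Proof.
  intros P H Hl.
  assert (Mono : forall s t, (s <= t)%R -> (sqnorm (x t) <= sqnorm (x s))%R)
    by (intros s t; apply (gauged_nonincreasing q lam); [lra | exact H]).
  destruct (decreasing_limit_p_infty (fun t => sqnorm (x t)) Mono (fun t => sqnorm_ge0 (x t)))
    as [L HL].
  assert (K : filterlim (fun t => Cmod (snd (x t)) ^ 2)%R (Rbar_locally p_infty)
            (locally (L - Cmod l ^ 2)%R)).
  { apply (filterlim_ext (fun t => plus (sqnorm (x t)) (opp (Cmod (fst (x t)) ^ 2)%R))).
    { intros t. unfold plus, opp, sqnorm; simpl. ring. }
    eapply filterlim_comp_2; [exact HL | |
      exact (filterlim_plus (V := R_NormedModule) L (opp (Cmod l ^ 2)%R))].
    eapply filterlim_comp; [exact (tends_Cmod_sqr _ _ Hl) |].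
    exact (filterlim_opp (V := R_NormedModule) _). }
  set (m := (L - Cmod l ^ 2)%R) in *.
  assert (M0 : (m <= 0)%R).
  { destruct (Rle_dec m 0) as [| N]; [assumption | exfalso].
    assert (Pm : (0 < m / 2)%R) by lra.
    destruct (proj1 (filterlim_locally _ _) K (mkposreal _ Pm)) as [T HT].
    assert (B : forall t, (T < t)%R -> (m / 2 <= Cmod (snd (x t)) ^ 2)%R).
    { intros t Ht. specialize (HT t Ht).
      change (Rabs (Cmod (snd (x t)) ^ 2 - m) < m / 2)%R in HT.
      apply Rabs_def2 in HT. lra. }
    set (c := (2 * Im lam * m)%R). assert (Pc : (0 < c)%R) by (unfold c; nra).
    (* Beyond T the energy loses at least c per unit of time, so that it would be
       exhausted after the time k. *)
    set (k := (sqnorm (x (T + 1)) / c + 1)%R).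
    assert (Pk : (0 < k)%R).
    { unfold k. pose proof (sqnorm_ge0 (x (T + 1))%R).
      assert (0 <= sqnorm (x (T + 1)) / c)%R; [| lra].
      apply Rmult_le_pos; [assumption | left; now apply Rinv_0_lt_compat]. }
    destruct (mean_value (fun t => sqnorm (x t))
      (fun u => - 4 * Im lam * Cmod (snd (x u)) ^ 2)%R (T + 1) (T + 1 + k)) as [u [I E]].
    - lra.
    - intros u _. now apply (gauged_energy q).
    - pose proof (B u ltac:(lra)) as Bu. pose proof (sqnorm_ge0 (x (T + 1 + k))%R).
      assert (- 4 * Im lam * Cmod (snd (x u)) ^ 2 <= - c)%R by (unfold c; nra).
      assert (c * k = sqnorm (x (T + 1)) + c)%R by (unfold k; field; lra).
      nra. }
  apply tends_iff. intros eps.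
  assert (Pe : (0 < eps ^ 2)%R) by (apply pow_lt, cond_pos).
  refine (filter_imp _ _ _ (proj1 (filterlim_locally _ _) K (mkposreal _ Pe))).
  intros t Ht. change (Rabs (Cmod (snd (x t)) ^ 2 - m) < eps ^ 2)%R in Ht.
  apply Rabs_def2 in Ht. replace (snd (x t) - 0) with (snd (x t)) by ring.
  pose proof (Cmod_ge_0 (snd (x t))). pose proof (cond_pos eps). nra.
Qed.

(** * Reflection of the time axis *)

(** Reversing time and exchanging the components sends solutions for [q] to
    solutions for the potential [conj (q (- t))] with the same spectral
    parameter, and exchanges the two ends of the line. *)
Definition reflect (phi : R -> C * C) (t : R) : C * C :=
  (snd (phi (- t)%R), fst (phi (- t)%R)).

Lemma is_derive_reverse (f : R -> C) (t : R) (l : C) :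
  is_derive f (- t)%R l -> is_derive (fun s => f (- s)%R) t (- l).
Proof.
  intros F.
  apply is_derive_eq with (scal (-1)%R l).
  - apply (is_derive_comp (V := C_R_NormedModule) f Ropp t l (-1)%R F).
    auto_derive; [exact I | ring].
  - exact (scal_opp_one (V := C_R_NormedModule) l).
Qed.

Lemma solves_t_reflect (q : R -> C) (lam : C) (phi : R -> C * C) :
  solves_t q lam phi -> solves_t (fun t => Cconj (q (- t)%R)) lam (reflect phi).
Proof.
  intros H. apply solves_t_iff. intros t.
  destruct (proj1 (solves_t_iff _ _ _) H (- t)%R) as [F G].
  unfold reflect; cbn [fst snd]. rewrite Cconj_conj. split.
  - eapply is_derive_Ceq; [exact (is_derive_reverse _ _ _ G) | ring].
  - eapply is_derive_Ceq; [exact (is_derive_reverse _ _ _ F) | ring].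
Qed.

Lemma tends_reverse_p_infty (f : R -> C) (l : C) :
  tends (Rbar_locally p_infty) f l ->
  tends (Rbar_locally m_infty) (fun t => f (- t)%R) l.
Proof. intros H. exact (filterlim_comp _ _ _ _ _ _ _ _
  (filterlim_Rbar_opp m_infty) H). Qed.

Lemma tends_reverse_m_infty (f : R -> C) (l : C) :
  tends (Rbar_locally m_infty) f l ->
  tends (Rbar_locally p_infty) (fun t => f (- t)%R) l.
Proof. intros H. exact (filterlim_comp _ _ _ _ _ _ _ _
  (filterlim_Rbar_opp p_infty) H). Qed.

Lemma reflect_phase (lam : C) (t : R) : - Ci * lam * RtoC (- t)%R = Ci * lam * t.
Proof. rewrite RtoC_opp. ring. Qed.

(** With its mirror image [recessive_m_infty] this controls the other component
    of psi at each end: when the limit [l] is non-zero, the direction of the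
    solution tends to a coordinate axis. *)
Lemma recessive_p_infty (q : R -> C) (lam : C) (phi : R -> C * C) (l : C) :
  (0 < Im lam)%R -> solves_t q lam phi ->
  tends (Rbar_locally p_infty) (fun t => Cexp (Ci * lam * t) * fst (phi t)) l ->
  tends (Rbar_locally p_infty) (fun t => Cexp (Ci * lam * t) * snd (phi t)) 0.
Proof.
  intros P S H.
  exact (gauged_recessive q lam (gauge lam phi) l P (gauge_gauged _ _ _ S) H).
Qed.

Lemma recessive_m_infty (q : R -> C) (lam : C) (phi : R -> C * C) (l : C) :
  (0 < Im lam)%R -> solves_t q lam phi ->
  tends (Rbar_locally m_infty) (fun t => Cexp (- Ci * lam * t) * snd (phi t)) l ->
  tends (Rbar_locally m_infty) (fun t => Cexp (- Ci * lam * t) * fst (phi t)) 0.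
Proof.
  intros P S H. apply tends_reverse_m_infty in H.
  assert (E : tends (Rbar_locally p_infty)
     (fun t => Cexp (Ci * lam * t) * snd (reflect phi t)) 0).
  { apply (recessive_p_infty _ lam _ l P (solves_t_reflect _ _ _ S)).
    revert H. apply filterlim_ext. intros t. now rewrite reflect_phase. }
  apply tends_reverse_p_infty in E. revert E. apply filterlim_ext. intros t. simpl.
  rewrite Ropp_involutive, <- reflect_phase, Ropp_involutive. reflexivity.
Qed.

(** This bound, valid on the real axis too, is what makes the vanishing
    off-diagonal entries of the dressing harmless at plus infinity. *)
Lemma jostN_sqnorm_le_1 (q : R -> C) (lam : C) (phi : R -> C * C) :
  (0 <= Im lam)%R -> jostN q lam phi -> forall t, (sqnorm (gauge lam phi t) <= 1)%R.
Proof.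
  intros P [S [H0 H1]] t.
  replace 1%R with (sqnorm (RtoC 1, RtoC 0))
    by (unfold sqnorm; simpl; rewrite Cmod_0, Cmod_1; ring).
  exact (gauged_le_limit q lam (gauge lam phi) 1 0 P (gauge_gauged _ _ _ S) H0 H1 t).
Qed.

(** In the gauge the difference of two such solutions tends to 0 at minus
    infinity, and its energy decreases from there. *)
Lemma jostN_unique (q : R -> C) (lam : C) (phi chi : R -> C * C) :
  (0 <= Im lam)%R -> jostN q lam phi -> jostN q lam chi -> forall t, phi t = chi t.
Proof.
  intros P [S [H0 H1]] [S' [K0 K1]] t.
  set (x := gauge lam phi). set (y := gauge lam chi).
  set (d := fun t => (fst (x t) - fst (y t), snd (x t) - snd (y t))).
  assert (Gd : gauged q lam d).
  { intros s. destruct (gauge_gauged _ _ _ S s) as [F G].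
    destruct (gauge_gauged _ _ _ S' s) as [F' G']. unfold d; cbn [fst snd]. split.
    - eapply is_derive_Ceq; [exact (is_derive_Cminus _ _ _ _ _ F F') |].
      unfold x, y. ring.
    - eapply is_derive_Ceq; [exact (is_derive_Cminus _ _ _ _ _ G G') |].
      unfold x, y. ring. }
  assert (Z : d t = (RtoC 0, RtoC 0)).
  { apply sqnorm_eq0. apply Rle_antisym; [| apply sqnorm_ge0].
    replace 0%R with (sqnorm (1 - 1, 0 - 0)).
    - apply (gauged_le_limit q lam d); auto.
      + exact (tends_minus _ _ _ _ H0 K0).
      + exact (tends_minus _ _ _ _ H1 K1).
    - replace (1 - 1) with (RtoC 0) by ring. replace (0 - 0) with (RtoC 0) by ring.
      unfold sqnorm; simpl. rewrite Cmod_0. ring. }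
  unfold d, x, y, gauge, cscale in Z; cbn [fst snd] in Z.
  pose proof (Cexp_neq0 (Ci * lam * t)) as N.
  assert (U : forall z w : C, Cexp (Ci * lam * t) * z - Cexp (Ci * lam * t) * w = 0 -> z = w).
  { intros z w E. replace w with (z - / Cexp (Ci * lam * t) *
      (Cexp (Ci * lam * t) * z - Cexp (Ci * lam * t) * w)) by (field; exact N).
    rewrite E. ring. }
  injection Z as Z1 Z2. 
  rewrite (surjective_pairing (phi t)), (surjective_pairing (chi t)).
  f_equal; apply U; unfold Cminus, Cplus, Copp, Cmult, RtoC; simpl; f_equal; assumption.
Qed.

Lemma is_a_unique (q : R -> C) (lam alpha beta : C) :
  (0 <= Im lam)%R -> is_a q lam alpha -> is_a q lam beta -> alpha = beta.
Proof.
  intros P [f [g [N [_ [_ T]]]]] [f' [g' [N' [_ [_ T']]]]].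
  apply (tends_unique _ _ _ T). revert T'. apply filterlim_ext. intros t.
  now rewrite (jostN_unique _ _ _ _ P N N' t).
Qed.

Lemma is_b_unique (q : R -> C) (lam alpha beta : C) :
  (0 <= Im lam)%R -> is_b q lam alpha -> is_b q lam beta -> alpha = beta.
Proof.
  intros P [f [g [N [_ [T _]]]]] [f' [g' [N' [_ [T' _]]]]].
  apply (tends_unique _ _ _ T). revert T'. apply filterlim_ext. intros t.
  now rewrite (jostN_unique _ _ _ _ P N N' t).
Qed.

(** * Continuity of the scattering function a *)

Lemma Re_mult_le (x y : C) : (Re (x * y) <= Cmod x * Cmod y)%R.
Proof.
  rewrite <- Cmod_mult. eapply Rle_trans; [apply Rle_abs | apply Re_le_Cmod].
Qed.

(** Let x and y be the two Jost solutions in their gauges and d = x - y. The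
    equation for d has the extra source 2j(lam - mu) y_2, so that
    (|d|^2)' <= |lam - mu|^2 |y_2|^2 / Im(lam) by completing the square,
    while (|y|^2)' = - 4 Im(mu) |y_2|^2. Hence |d|^2 + K |y|^2
    decreases for the bound K of the statement, and its limit at minus
    infinity, where d vanishes and |y| = 1, is K itself. At plus infinity
    d_1 tends to the difference of the two values of a. *)
Lemma is_a_lipschitz (q : R -> C) (lam mu alpha beta : C) :
  (0 < Im lam)%R -> (0 < Im mu)%R -> is_a q lam alpha -> is_a q mu beta ->
  (Cmod (alpha - beta) ^ 2 <= Cmod (lam - mu) ^ 2 / (4 * Im lam * Im mu))%R.
Proof.
  intros Pl Pm [phi [g [[S [H0 H1]] [_ [_ T]]]]] [chi [g' [[S' [K0 K1]] [_ [_ T']]]]].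
  set (x := gauge lam phi). set (y := gauge mu chi).
  set (d := fun t => (fst (x t) - fst (y t), snd (x t) - snd (y t))).
  set (K := (Cmod (lam - mu) ^ 2 / (4 * Im lam * Im mu))%R).
  set (f := fun t => (sqnorm (d t) + K * sqnorm (y t))%R).
  set (df := fun t => ((- 4 * Im lam * Cmod (snd (d t)) ^ 2 +
      4 * Re (Ci * (lam - mu) * (Cconj (snd (d t)) * snd (y t)))) +
      K * (- 4 * Im mu * Cmod (snd (y t)) ^ 2))%R).
  assert (D : forall t, is_derive f t (df t)).
  { intros t. apply (is_derive_plus (V := R_NormedModule)).
    - destruct (gauge_gauged _ _ _ S t) as [F G].
      destruct (gauge_gauged _ _ _ S' t) as [F' G']. fold x in F, G. fold y in F', G'.
      eapply is_derive_eq.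
      + exact (is_derive_sqnorm d t _ _ (is_derive_Cminus _ _ _ _ _ F F')
          (is_derive_Cminus _ _ _ _ _ G G')).
      + rewrite Cmod_sqr. unfold d; cbn [fst snd].
        destruct (x t) as [[x1 x1'] [x2 x2']], (y t) as [[y1 y1'] [y2 y2']], (q t), lam, mu.
        unfold Re, Im, Cconj, Cminus, Cmult, Cplus, Copp, Ci, RtoC; simpl. ring.
    - apply is_derive_scal. apply (gauged_energy q). exact (gauge_gauged _ _ _ S'). }
  assert (Neg : forall t, (df t <= 0)%R).
  { intros t. unfold df.
    pose proof (Re_mult_le (Ci * (lam - mu)) (Cconj (snd (d t)) * snd (y t))) as B.
    rewrite !Cmod_mult, Cmod_conj, Cmod_Ci, Rmult_1_l in B.
    set (r := Re _) in *. set (e := Cmod (lam - mu)) in *.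
    set (u := Cmod (snd (d t))) in *. set (w := Cmod (snd (y t))) in *.
    replace (K * (- 4 * Im mu * w ^ 2))%R with (- (e * w) ^ 2 / Im lam)%R
      by (unfold K; fold e; field; lra).
    apply Rmult_le_reg_l with (Im lam); [exact Pl |].
    replace (Im lam * (- 4 * Im lam * u ^ 2 + 4 * r + - (e * w) ^ 2 / Im lam))%R
      with (- (2 * Im lam * u) ^ 2 + 4 * Im lam * r - (e * w) ^ 2)%R by (field; lra).
    assert (Im lam * r <= Im lam * (e * (u * w)))%R by (apply Rmult_le_compat_l; lra).
    (* After multiplication by Im(lam) the bound is minus this square. *)
    pose proof (pow2_ge_0 (2 * Im lam * u - e * w)). nra. }
  assert (PK : (0 <= K)%R).
  { unfold K. apply Rmult_le_pos; [apply pow2_ge_0 |].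
    left. apply Rinv_0_lt_compat. nra. }
  assert (Lim : filterlim f (Rbar_locally m_infty) (locally K)).
  { assert (EK : K = plus (sqnorm (1 - 1, 0 - 0)) (scal K (sqnorm (RtoC 1, RtoC 0)))).
    { replace (1 - 1) with (RtoC 0) by ring. replace (0 - 0) with (RtoC 0) by ring.
      unfold plus, scal, sqnorm; simpl. unfold mult; simpl. rewrite Cmod_0, Cmod_1. ring. }
    rewrite EK.
    eapply filterlim_comp_2; [| | exact (filterlim_plus (V := R_NormedModule) _ _)].
    - apply (tends_sqnorm d);
        [exact (tends_minus _ _ _ _ H0 K0) | exact (tends_minus _ _ _ _ H1 K1)].
    - eapply filterlim_comp; [exact (tends_sqnorm y _ _ K0 K1) |].
      exact (filterlim_scal_r (V := R_NormedModule) K _). }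
  assert (B : forall t, (f t <= K)%R).
  { apply le_limit_m_infty; [| exact Lim].
    intros s t L. apply (nonincreasing f df s t L); auto. }
  assert (B' : forall t, (Cmod (fst (x t) - fst (y t)) ^ 2 <= K)%R).
  { intros t. pose proof (B t) as Bt. unfold f in Bt.
    pose proof (sqnorm_ge0 (y t)). unfold sqnorm at 1 in Bt. unfold d in Bt. cbn [fst snd] in Bt.
    pose proof (pow2_ge_0 (Cmod (snd (x t) - snd (y t)))). nra. }
  refine (filterlim_le (F := Rbar_locally p_infty)
    (fun t => Cmod (fst (x t) - fst (y t)) ^ 2)%R (fun _ => K)
    (Finite (Cmod (alpha - beta) ^ 2)) (Finite K) _ _ _).
  - exists 0%R. intros t _. apply B'.
  - exact (tends_Cmod_sqr _ _ (tends_minus _ _ _ _ T T')).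
  - apply filterlim_const.
Qed.

Lemma Im_ball (z y : C) : (Cmod (y - z) < Im z / 2)%R -> (Im z / 2 < Im y)%R.
Proof.
  intros H. pose proof (Rle_trans _ _ _ (Rmax_r _ _) (Rmax_Cmod (y - z))) as M.
  assert (E : snd (y - z) = (Im y - Im z)%R) by (unfold Im; simpl; ring).
  rewrite E in M. pose proof (Rabs_maj2 (Im y - Im z)). lra.
Qed.

Lemma continuous_a (q : R -> C) (a : C -> C) (lam : C) :
  (forall mu, (0 <= Im mu)%R -> is_a q mu (a mu)) -> (0 < Im lam)%R ->
  continuous a lam.
Proof.
  intros A P. apply continuous_C_iff. intros eps. pose proof (cond_pos eps) as Pe.
  assert (Pd : (0 < Rmin (Im lam / 2) (eps * Im lam))%R) by (apply Rmin_pos; nra).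
  exists (mkposreal _ Pd). simpl. intros y Hy.
  pose proof (Rmin_l (Im lam / 2) (eps * Im lam)).
  pose proof (Rmin_r (Im lam / 2) (eps * Im lam)).
  assert (Py : (Im lam / 2 < Im y)%R) by (apply Im_ball; lra).
  pose proof (is_a_lipschitz q y lam (a y) (a lam) ltac:(lra) P (A y ltac:(lra))
    (A lam ltac:(lra))) as B.
  pose proof (Cmod_ge_0 (y - lam)). pose proof (Cmod_ge_0 (a y - a lam)).
  assert (D : (Cmod (y - lam) ^ 2 / (4 * Im y * Im lam) < eps ^ 2)%R).
  { assert (Pq : (0 < 4 * Im y * Im lam)%R) by nra.
    apply Rmult_lt_reg_r with (4 * Im y * Im lam)%R; [exact Pq |].
    unfold Rdiv. rewrite Rmult_assoc, Rinv_l, Rmult_1_r by lra.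
    apply Rlt_trans with ((eps * Im lam) ^ 2)%R; [nra |].
    replace ((eps * Im lam) ^ 2)%R with (eps ^ 2 * (Im lam * Im lam))%R by ring.
    apply Rmult_lt_compat_l; nra. }
  nra.
Qed.

(** * Algebra of the dressing transformation *)

(** The coefficient of [p] in the orthogonal projection of [v] to the line
    spanned by [p]. *)
Definition overlap (p v : C * C) : C :=
  (Cconj (fst p) * fst v + Cconj (snd p) * snd v) /
  (fst p * Cconj (fst p) + snd p * Cconj (snd p)).

(** [Psi] has the eigenvectors [p] and its orthogonal vector as columns, so
    Sigma is conj(lam0) plus (lam0 - conj(lam0)) times the orthogonal
    projection to [p]. In this form the asymptotics of Sigma can be read off
    from those of the projection. *)
Lemma dressing_formula (lam0 mu : C) (p v : C * C) :
  p <> (RtoC 0, RtoC 0) ->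
  act (subm (diag2 mu mu) (Sigma lam0 p)) v =
    ((mu - Cconj lam0) * fst v - (lam0 - Cconj lam0) * overlap p v * fst p,
     (mu - Cconj lam0) * snd v - (lam0 - Cconj lam0) * overlap p v * snd p).
Proof.
  intros N. apply sqnorm_C_neq0 in N.
  destruct p as [p1 p2], v as [v1 v2]. unfold overlap; cbn [fst snd] in *.
  assert (N' : p1 * (- Cconj p1) - Cconj p2 * p2 <> 0).
  { intros H. apply N.
    transitivity (- (p1 * (- Cconj p1) - Cconj p2 * p2)); [ring |].
    rewrite H. ring. }
  unfold act, subm, Sigma, mulm, invm, det2, Psi, diag2, mx2, entry, coeff_mat.
  unfold Mmult, Mplus, Mopp, mk_matrix, coeff_mat; simpl.
  unfold sum_n, sum_n_m, Iter.iter_nat; simpl.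
  unfold plus, mult, opp, zero; simpl.
  set (c1 := Cconj p1) in *. set (c2 := Cconj p2) in *. set (l := Cconj lam0) in *.
  f_equal; field; auto.
Qed.

Lemma conj_RtoC (r : R) : Cconj (RtoC r) = RtoC r.
Proof. unfold Cconj, RtoC; simpl. f_equal; ring. Qed.

(** The new potential as a function of the values of [q] and psi at a point,
    with the squared norm written as a polynomial in psi and its conjugate so
    that [field] can treat the conjugates as independent variables. *)
Definition dressed_q (lam0 q : C) (p : C * C) : C :=
  q - 2 * Ci * (lam0 - Cconj lam0) *
    (Cconj (snd p) * fst p / (fst p * Cconj (fst p) + snd p * Cconj (snd p))).

Lemma darboux_dressed (lam0 : C) (psi : R -> R -> C * C) (q : R -> R -> C) (t z : R) :
  darboux lam0 psi q t z = dressed_q lam0 (q t z) (psi t z).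
Proof. unfold darboux, dressed_q. rewrite <- sqnorm_C. reflexivity. Qed.

Lemma dressed_q_conj (lam0 q : C) (p : C * C) : p <> (RtoC 0, RtoC 0) ->
  Cconj (dressed_q lam0 q p) = Cconj q - 2 * Ci * (lam0 - Cconj lam0) *
    (snd p * Cconj (fst p) / (fst p * Cconj (fst p) + snd p * Cconj (snd p))).
Proof.
  intros N. apply sqnorm_C_neq0 in N. unfold dressed_q.
  rewrite Cminus_conj, !Cmult_conj, Cdiv_conj, Cminus_conj, Cplus_conj, !Cmult_conj by exact N.
  rewrite !Cconj_conj, Ci_conj, conj_RtoC. field.
  intros H. apply N. rewrite <- H. ring.
Qed.

Definition dressed (lam0 mu : C) (p v : C * C) : C * C :=
  ((mu - Cconj lam0) * fst v - (lam0 - Cconj lam0) * overlap p v * fst p,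
   (mu - Cconj lam0) * snd v - (lam0 - Cconj lam0) * overlap p v * snd p).

(** The derivative of [dressed] along a curve with velocities [dp] and [dv];
    keeping it symbolic lets the t- and the z-equation share one computation. *)
Definition dressed_derivative (lam0 mu : C) (p v dp dv : C * C) : C * C :=
  let n := fst p * Cconj (fst p) + snd p * Cconj (snd p) in
  let w := Cconj (fst p) * fst v + Cconj (snd p) * snd v in
  let dw := Cconj (fst dp) * fst v + Cconj (fst p) * fst dv +
            (Cconj (snd dp) * snd v + Cconj (snd p) * snd dv) in
  let dn := fst dp * Cconj (fst p) + fst p * Cconj (fst dp) +
            (snd dp * Cconj (snd p) + snd p * Cconj (snd dp)) in
  let doverlap := (dw * n - w * dn) / (n * n) in
  let du vk dvk pk dpk :=
    (mu - Cconj lam0) * dvk - (lam0 - Cconj lam0) * (doverlap * pk + w / n * dpk) in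
  (du (fst v) (fst dv) (fst p) (fst dp), du (snd v) (snd dv) (snd p) (snd dp)).

Lemma is_derive_dressed (lam0 mu : C) (p v : R -> C * C) (s : R) (dp dv : C * C) :
  p s <> (RtoC 0, RtoC 0) -> is_derive p s dp -> is_derive v s dv ->
  is_derive (fun x => dressed lam0 mu (p x) (v x)) s (dressed_derivative lam0 mu (p s) (v s) dp dv).
Proof.
  intros N P V. apply sqnorm_C_neq0 in N.
  destruct (is_derive_C2 _ _ _ P) as [P1 P2].
  destruct (is_derive_C2 _ _ _ V) as [V1 V2].
  assert (O : is_derive (fun x => overlap (p x) (v x)) s
    (((Cconj (fst dp) * fst (v s) + Cconj (fst (p s)) * fst dv +
       (Cconj (snd dp) * snd (v s) + Cconj (snd (p s)) * snd dv)) *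
       / (fst (p s) * Cconj (fst (p s)) + snd (p s) * Cconj (snd (p s)))) +
     (Cconj (fst (p s)) * fst (v s) + Cconj (snd (p s)) * snd (v s)) *
     (- (fst dp * Cconj (fst (p s)) + fst (p s) * Cconj (fst dp) +
            (snd dp * Cconj (snd (p s)) + snd (p s) * Cconj (snd dp))) /
      ((fst (p s) * Cconj (fst (p s)) + snd (p s) * Cconj (snd (p s))) *
       (fst (p s) * Cconj (fst (p s)) + snd (p s) * Cconj (snd (p s))))))).
  { unfold overlap, Cdiv.
    exact (is_derive_Cmult _ _ _ _ _
      (is_derive_Cplus _ _ _ _ _ (is_derive_Cmult _ _ _ _ _ (is_derive_Cconj _ _ _ P1) V1)
         (is_derive_Cmult _ _ _ _ _ (is_derive_Cconj _ _ _ P2) V2))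
      (is_derive_Cinv _ _ _
        (is_derive_Cplus _ _ _ _ _ (is_derive_Cmult _ _ _ _ _ P1 (is_derive_Cconj _ _ _ P1))
         (is_derive_Cmult _ _ _ _ _ P2 (is_derive_Cconj _ _ _ P2))) N)). }
  apply (is_derive_pair (U := C_R_NormedModule) (V := C_R_NormedModule)).
  - eapply is_derive_Ceq.
    + exact (is_derive_Cminus _ _ _ _ _
       (is_derive_Cmult _ _ _ _ _ (is_derive_Cconst _ s) V1)
       (is_derive_Cmult _ _ _ _ _
         (is_derive_Cmult _ _ _ _ _ (is_derive_Cconst _ s) O) P1)).
    + unfold overlap; cbv beta zeta. field. exact N.
  - eapply is_derive_Ceq.
    + exact (is_derive_Cminus _ _ _ _ _
       (is_derive_Cmult _ _ _ _ _ (is_derive_Cconst _ s) V2)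
       (is_derive_Cmult _ _ _ _ _
         (is_derive_Cmult _ _ _ _ _ (is_derive_Cconst _ s) O) P2)).
    + unfold overlap; cbv beta zeta. field. exact N.
Qed.

Definition dressed_qt (lam0 qt : C) (p dp : C * C) : C :=
  let n := fst p * Cconj (fst p) + snd p * Cconj (snd p) in
  let dn := fst dp * Cconj (fst p) + fst p * Cconj (fst dp) +
            (snd dp * Cconj (snd p) + snd p * Cconj (snd dp)) in
  qt - 2 * Ci * (lam0 - Cconj lam0) *
    (((Cconj (snd dp) * fst p + Cconj (snd p) * fst dp) * n
      - Cconj (snd p) * fst p * dn) / (n * n)).

Lemma is_derive_dressed_q (lam0 : C) (q : R -> C) (p : R -> C * C) (s : R) (dq : C) (dp : C * C) :
  p s <> (RtoC 0, RtoC 0) -> is_derive q s dq -> is_derive p s dp ->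
  is_derive (fun x => dressed_q lam0 (q x) (p x)) s (dressed_qt lam0 dq (p s) dp).
Proof.
  intros N Q P. apply sqnorm_C_neq0 in N.
  destruct (is_derive_C2 _ _ _ P) as [P1 P2].
  eapply is_derive_Ceq.
  - exact (is_derive_Cminus _ _ _ _ _ Q
      (is_derive_Cmult _ _ _ _ _ (is_derive_Cconst _ s)
       (is_derive_Cmult _ _ _ _ _ (is_derive_Cmult _ _ _ _ _ (is_derive_Cconj _ _ _ P2) P1)
      (is_derive_Cinv _ _ _
        (is_derive_Cplus _ _ _ _ _ (is_derive_Cmult _ _ _ _ _ P1 (is_derive_Cconj _ _ _ P1))
         (is_derive_Cmult _ _ _ _ _ P2 (is_derive_Cconj _ _ _ P2))) N)))).
  - unfold dressed_qt; cbv beta zeta. field. exact N.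
Qed.

(** The intertwining relation: the derivative of the dressing matrix D along
    the flow satisfies D_t = P(new q) D - D P(q). Here and in [dressing_z] it is
    checked by treating the conjugates as free variables, modulo j^2 = -1. *)
Lemma dressing_t (lam0 mu q : C) (p v : C * C) : p <> (RtoC 0, RtoC 0) ->
  dressed_derivative lam0 mu p v (act (laxP q lam0) p) (act (laxP q mu) v) =
    act (laxP (dressed_q lam0 q p) mu) (dressed lam0 mu p v).
Proof.
  intros N. unfold laxP. rewrite !act_mx2, dressed_q_conj by exact N.
  apply sqnorm_C_neq0 in N.
  unfold dressed_derivative, dressed, overlap, dressed_q. cbv zeta. cbn [fst snd].
  rewrite !Cplus_conj, !Cmult_conj, !Copp_conj, !Cconj_conj, !Ci_conj.
  destruct p as [p1 p2], v as [v1 v2]; cbn [fst snd] in *.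
  generalize dependent (Cconj p1). generalize dependent (Cconj p2). intros c2 c1 N.
  generalize (Cconj q) as qc. generalize (Cconj lam0) as l. intros l qc.
  pose proof Ci_sqr as J.
  f_equal; field [J]; exact N.
Qed.

Lemma dressed_qt_conj (lam0 qt : C) (p dp : C * C) : p <> (RtoC 0, RtoC 0) ->
  Cconj (dressed_qt lam0 qt p dp) =
  let n := fst p * Cconj (fst p) + snd p * Cconj (snd p) in
  let dn := fst dp * Cconj (fst p) + fst p * Cconj (fst dp) +
            (snd dp * Cconj (snd p) + snd p * Cconj (snd dp)) in
  Cconj qt - 2 * Ci * (lam0 - Cconj lam0) *
    (((snd dp * Cconj (fst p) + snd p * Cconj (fst dp)) * n
      - snd p * Cconj (fst p) * dn) / (n * n)).
Proof.
  intros N. apply sqnorm_C_neq0 in N. unfold dressed_qt; cbv zeta.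
  assert (R : forall x y : C, Cconj (x * Cconj x + y * Cconj y) = x * Cconj x + y * Cconj y).
  { intros x y. rewrite Cplus_conj, !Cmult_conj, !Cconj_conj. ring. }
  rewrite Cminus_conj, Cmult_conj, Cdiv_conj by (now apply Cmult_neq_0).
  rewrite (Cmult_conj (_ + _) (_ + _)), !R.
  rewrite !Cminus_conj, !Cmult_conj, !Cplus_conj, !Cmult_conj, !Cminus_conj, !Cconj_conj,
    Ci_conj, conj_RtoC.
  field. exact N.
Qed.

Lemma dressing_z (lam0 mu q qt : C) (p v : C * C) : p <> (RtoC 0, RtoC 0) ->
  dressed_derivative lam0 mu p v (act (laxM q qt lam0) p) (act (laxM q qt mu) v) =
    act (laxM (dressed_q lam0 q p) (dressed_qt lam0 qt p (act (laxP q lam0) p)) mu)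
      (dressed lam0 mu p v).
Proof.
  intros N. unfold laxM. rewrite !Cmod2_conj, !act_mx2, dressed_q_conj, dressed_qt_conj by exact N.
  apply sqnorm_C_neq0 in N.
  unfold dressed_derivative, dressed, overlap, dressed_q, dressed_qt, laxP.
  rewrite !act_mx2. cbv zeta.
  cbn [fst snd].
  repeat rewrite ?Cplus_conj, ?Cminus_conj, ?Copp_conj, ?Cmult_conj, ?Cpow_conj,
    ?Cconj_conj, ?Ci_conj, ?conj_RtoC.
  destruct p as [p1 p2], v as [v1 v2]; cbn [fst snd] in *.
  generalize dependent (Cconj p1). generalize dependent (Cconj p2). intros c2 c1 N.
  generalize (Cconj q) as qc. generalize (Cconj qt) as qtc. generalize (Cconj lam0) as l.
  intros l qtc qc.
  pose proof Ci_sqr as J.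
  f_equal; field [J]; exact N.
Qed.

(** * Dressing of solutions of the Lax pair *)

Lemma solves_t_ext (q q' : R -> C) (lam : C) (phi chi : R -> C * C) :
  (forall t, q t = q' t) -> (forall t, phi t = chi t) ->
  solves_t q lam phi -> solves_t q' lam chi.
Proof.
  intros Eq Ep H t. rewrite <- Eq, <- Ep.
  exact (is_derive_ext _ _ t _ Ep (H t)).
Qed.

Lemma solves_t_scale (q : R -> C) (lam c : C) (phi : R -> C * C) :
  solves_t q lam phi -> solves_t q lam (fun t => cscale c (phi t)).
Proof.
  intros H. apply solves_t_iff. intros t.
  destruct (proj1 (solves_t_iff _ _ _) H t) as [F G].
  unfold cscale; cbn [fst snd].
  split; (eapply is_derive_Ceq;
    [apply is_derive_Cmult; [apply is_derive_Cconst | eassumption] | cbv beta; ring]).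
Qed.

Lemma solves_t_dressed (q : R -> C) (lam0 mu : C) (p v : R -> C * C) :
  (forall t, p t <> (RtoC 0, RtoC 0)) -> solves_t q lam0 p -> solves_t q mu v ->
  solves_t (fun t => dressed_q lam0 (q t) (p t)) mu (fun t => dressed lam0 mu (p t) (v t)).
Proof.
  intros N P V t. rewrite <- dressing_t by apply N.
  now apply is_derive_dressed.
Qed.

Lemma solves_lax_dressed (q : R -> R -> C) (lam0 mu : C) (psi v : R -> R -> C * C) :
  (forall t z, psi t z <> (RtoC 0, RtoC 0)) ->
  solves_lax q lam0 psi -> solves_lax q mu v ->
  solves_lax (darboux lam0 psi q) mu
    (fun t z => act (subm (diag2 mu mu) (Sigma lam0 (psi t z))) (v t z)).
Proof.
  intros N [Pt Pz] [Vt Vz]. split.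
  - intros z.
    refine (solves_t_ext _ _ _ _ _ _ _ (solves_t_dressed (fun t => q t z) lam0 mu
      (fun t => psi t z) (fun t => v t z) (fun t => N t z) (Pt z) (Vt z))).
    + intros t. symmetry. apply darboux_dressed.
    + intros t. symmetry. apply dressing_formula, N.
  - intros t z.
    destruct (Pz t z) as [qt [Q P]], (Vz t z) as [qt' [Q' V]].
    (* Both z-equations contain the same q_t, by uniqueness of the derivative. *)
    rewrite (is_derive_C_unique _ _ _ _ Q' Q) in V.
    exists (dressed_qt lam0 qt (psi t z) (act (laxP (q t z) lam0) (psi t z))). split.
    + apply (is_derive_ext (fun s => dressed_q lam0 (q s z) (psi s z))).
      { intros s. symmetry. apply darboux_dressed. }
      exact (is_derive_dressed_q lam0 (fun s => q s z) (fun s => psi s z) t _ _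
        (N t z) Q (Pt z t)).
    + rewrite darboux_dressed, dressing_formula by apply N.
      fold (dressed lam0 mu (psi t z) (v t z)). rewrite <- dressing_z by apply N.
      apply (is_derive_ext (fun y => dressed lam0 mu (psi t y) (v t y))).
      { intros y. symmetry. apply dressing_formula, N. }
      exact (is_derive_dressed lam0 mu (psi t) (v t) z _ _ (N t z) P V).
Qed.

Lemma continuous_laxP (q : R -> C) (lam : C) (t : R) (k l : nat) :
  continuous q t -> continuous (fun s => entry (laxP (q s) lam) k l) t.
Proof.
  intros Q.
  assert (Z : tends (locally t) (fun _ => RtoC 0) (RtoC 0)) by apply tends_const.
  destruct k as [| [| k]], l as [| [| l]]; try exact Z.
  all: try apply continuous_const.
  - exact Q.
  - apply tends_opp, tends_conj, Q.
Qed.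

Lemma continuous_laxM (q qt : R -> C) (lam : C) (t : R) (k l : nat) :
  continuous q t -> continuous qt t ->
  continuous (fun s => entry (laxM (q s) (qt s) lam) k l) t.
Proof.
  intros Q Qt.
  assert (K : forall c : C, tends (locally t) (fun _ => c) c) by (intros; apply tends_const).
  assert (S : tends (locally t) (fun s => RtoC (Cmod (q s) ^ 2)) (RtoC (Cmod (q t) ^ 2))).
  { apply (tends_eq (fun s => q s * Cconj (q s)) _ (q t * Cconj (q t)) _).
    - intros s. now rewrite Cmod2_conj.
    - now rewrite Cmod2_conj.
    - apply tends_mult; [exact Q | apply tends_conj, Q]. }
  destruct k as [| [| k]], l as [| [| l]]; try exact (K 0).
  - apply tends_minus; [apply K | apply tends_mult; [apply K | exact S]].
  - apply tends_minus; apply tends_mult; first [apply K | exact Q | exact Qt].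
  - apply tends_minus; apply tends_mult; first [apply K | apply tends_conj; assumption].
  - apply tends_plus; [apply K | apply tends_mult; [apply K | exact S]].
Qed.

Lemma continuous_slice_t (f : R -> R -> C) (z t : R) :
  continuous (fun x : R * R => f (fst x) (snd x)) (t, z) -> continuous (fun s => f s z) t.
Proof.
  intros H. apply (continuous_comp_2 (fun s => s) (fun _ => z) f);
    [apply continuous_id | apply continuous_const | exact H].
Qed.

Lemma continuous_slice_z (f : R -> R -> C) (t z : R) :
  continuous (fun x : R * R => f (fst x) (snd x)) (t, z) -> continuous (fun y => f t y) z.
Proof.
  intros H. apply (continuous_comp_2 (fun _ => t) (fun y => y) f);
    [apply continuous_const | apply continuous_id | exact H].
Qed.

(** A zero of psi spreads along t by the first equation and then along z by the
    second, whose coefficients are continuous for a smooth potential; psi would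
    be identically 0. *)
Lemma lax_solution_neq0 (q : R -> R -> C) (lam : C) (psi : R -> R -> C * C) :
  smooth_potential q -> solves_lax q lam psi ->
  (exists t z, psi t z <> (RtoC 0, RtoC 0)) -> forall t z, psi t z <> (RtoC 0, RtoC 0).
Proof.
  intros [Cq [qt [Dq Cqt]]] [Pt Pz] [t0 [z0 N]] t z Z. apply N.
  apply (linear_ode_zero (fun y => laxM (q t0 y) (qt t0 y) lam) (psi t0) z z0).
  - intros y. destruct (Pz t0 y) as [qt' [D P]].
    now rewrite (is_derive_C_unique _ _ _ _ (Dq t0 y) D).
  - intros y k l. apply continuous_laxM.
    + apply (continuous_slice_z q), Cq.
    + apply (continuous_slice_z qt), Cqt.
  - apply (linear_ode_zero (fun s => laxP (q s z) lam) (fun s => psi s z) t t0).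
    + exact (Pt z).
    + intros s k l. apply continuous_laxP. apply (continuous_slice_t q), Cq.
    + exact Z.
Qed.

(** * Dressing of scattering data *)

Lemma Cconj_neq0 (c : C) : c <> 0 -> Cconj c <> 0.
Proof.
  intros N E. apply N. rewrite <- (Cconj_conj c), E. exact (conj_RtoC 0).
Qed.

(** The entries of the projector p p^* / n are homogeneous of degree 0, so p may
    be multiplied by a non-vanishing factor [c] for which it has a non-zero
    limit. [f] and [g] stand for components of [p]. *)
Lemma tends_projector {F : (R -> Prop) -> Prop} {FF : Filter F}
    (c f g : R -> C) (p : R -> C * C) (x y l m : C) :
  (forall t, c t <> 0) -> (forall t, p t <> (RtoC 0, RtoC 0)) ->
  (l, m) <> (RtoC 0, RtoC 0) ->
  tends F (fun t => c t * fst (p t)) l -> tends F (fun t => c t * snd (p t)) m ->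
  tends F (fun t => c t * f t) x -> tends F (fun t => c t * g t) y ->
  tends F (fun t => f t * Cconj (g t) /
      (fst (p t) * Cconj (fst (p t)) + snd (p t) * Cconj (snd (p t))))
    (x * Cconj y / (l * Cconj l + m * Cconj m)).
Proof.
  intros Nc Np Nl Hl Hm Hf Hg.
  refine (tends_eq _ _ _ _ _ eq_refl (tends_mult _ _ _ _
    (tends_mult _ _ _ _ Hf (tends_conj _ _ Hg))
    (tends_inv _ _ (sqnorm_C_neq0 (l, m) Nl) (tends_plus _ _ _ _
      (tends_mult _ _ _ _ Hl (tends_conj _ _ Hl))
      (tends_mult _ _ _ _ Hm (tends_conj _ _ Hm)))))).
  intros t. cbv beta. rewrite !Cmult_conj.
  pose proof (sqnorm_C_neq0 _ (Np t)). pose proof (Nc t). pose proof (Cconj_neq0 _ (Nc t)).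
  field. repeat split; auto.
  replace (_ + _) with (c t * Cconj (c t) *
    (fst (p t) * Cconj (fst (p t)) + snd (p t) * Cconj (snd (p t)))) by ring.
  now repeat apply Cmult_neq_0.
Qed.

Lemma tends_eventually_bounded {F : (R -> Prop) -> Prop} {FF : Filter F} (f : R -> C) (l : C) :
  tends F f l -> exists M, F (fun t => Cmod (f t) <= M)%R.
Proof.
  intros H. exists (Cmod l + 1)%R.
  refine (filter_imp _ _ _ (proj1 (tends_iff f l) H (mkposreal 1 Rlt_0_1))).
  simpl. intros t Ht. pose proof (Cmod_triangle (f t - l) l) as T.
  replace (f t - l + l) with (f t) in T by ring. lra.
Qed.

(** One component of a dressed solution: [pi] is the diagonal entry of the
    projector in its row and [pi'] the off-diagonal one. The other component
    [g] of the solution is only bounded, as happens on the real axis. *)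
Lemma tends_dressed_entry {F : (R -> Prop) -> Prop} {FF : Filter F}
    (pi pi' f g h : R -> C) (k al x : C) :
  (forall t, h t = f t - k * (pi t * f t + pi' t * g t)) ->
  tends F pi al -> tends F pi' 0 -> tends F f x ->
  (exists M, F (fun t => Cmod (g t) <= M)%R) -> tends F h ((1 - k * al) * x).
Proof.
  intros E Hp Hp' Hf [M Hg].
  refine (tends_eq _ _ _ _ (fun t => eq_sym (E t)) _ (tends_minus _ _ _ _ Hf
    (tends_mult _ _ _ _ (tends_const k) (tends_plus _ _ _ _ (tends_mult _ _ _ _ Hp Hf)
       (tends_bounded_mult _ _ M Hg Hp'))))).
  ring.
Qed.

Lemma Cmod_le_of_sqnorm (x : C * C) (r : R) : (0 <= r)%R -> (sqnorm x <= r ^ 2)%R ->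
  (Cmod (fst x) <= r)%R /\ (Cmod (snd x) <= r)%R.
Proof.
  unfold sqnorm. intros. pose proof (Cmod_ge_0 (fst x)). pose proof (Cmod_ge_0 (snd x)).
  split; nra.
Qed.

(** The matrix of the equation has trace 0. *)
Lemma wronskian_constant (q : R -> C) (lam : C) (f g : R -> C * C) (s t : R) :
  solves_t q lam f -> solves_t q lam g ->
  fst (f s) * snd (g s) - snd (f s) * fst (g s) =
  fst (f t) * snd (g t) - snd (f t) * fst (g t).
Proof.
  intros F G.
  assert (D : forall u, is_derive
    (fun u => fst (f u) * snd (g u) - snd (f u) * fst (g u)) u (RtoC 0)).
  { intros u. destruct (proj1 (solves_t_iff _ _ _) F u) as [F1 F2].
    destruct (proj1 (solves_t_iff _ _ _) G u) as [G1 G2].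
    eapply is_derive_Ceq.
    - exact (is_derive_Cminus _ _ _ _ _ (is_derive_Cmult _ _ _ _ _ F1 G2)
        (is_derive_Cmult _ _ _ _ _ F2 G1)).
    - cbv beta. ring. }
  destruct (Rtotal_order s t) as [L | [-> | L]]; [| reflexivity |].
  - exact (eq_is_derive (V := C_R_NormedModule) _ s t (fun u _ => D u) L).
  - symmetry. exact (eq_is_derive (V := C_R_NormedModule) _ t s (fun u _ => D u) L).
Qed.

Lemma Im_pos_neq_conj (lam lam0 : C) :
  (0 <= Im lam)%R -> (0 < Im lam0)%R -> lam - Cconj lam0 <> 0.
Proof.
  intros P P0 E. assert (I : Im (lam - Cconj lam0) = 0%R) by now rewrite E.
  unfold Im, Cminus, Cplus, Copp, Cconj in *; simpl in I. unfold Im in *. lra.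
Qed.

Section Scattering.
Context (q : R -> C) (lam0 : C) (p : R -> C * C) (m1 m2 : C).
Context (lam0_up : (0 < Im lam0)%R) (p_neq0 : forall t, p t <> (RtoC 0, RtoC 0))
  (p_solves : solves_t q lam0 p) (m1_neq0 : m1 <> 0) (m2_neq0 : m2 <> 0)
  (p_right : tends (Rbar_locally p_infty) (fun t => Cexp (Ci * lam0 * t) * fst (p t)) m1)
  (p_left : tends (Rbar_locally m_infty) (fun t => Cexp (- Ci * lam0 * t) * snd (p t)) m2).

Definition dressed_potential (t : R) : C := dressed_q lam0 (q t) (p t).

(** The limits of Sigma at the two ends differ by an exchange of lam0 and
    conj(lam0), and the two Jost conditions concern different components; this
    is why one factor normalizes both solutions, at lam = lam0 as well. *)
Definition dressed_jost (lam : C) (phi : R -> C * C) (t : R) : C * C :=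
  cscale (/ (lam - Cconj lam0)) (dressed lam0 lam (p t) (phi t)).

Let n (t : R) : C := fst (p t) * Cconj (fst (p t)) + snd (p t) * Cconj (snd (p t)).

Lemma projector_right :
  tends (Rbar_locally p_infty) (fun t => fst (p t) * Cconj (fst (p t)) / n t) 1 /\
  tends (Rbar_locally p_infty) (fun t => fst (p t) * Cconj (snd (p t)) / n t) 0 /\
  tends (Rbar_locally p_infty) (fun t => snd (p t) * Cconj (fst (p t)) / n t) 0 /\
  tends (Rbar_locally p_infty) (fun t => snd (p t) * Cconj (snd (p t)) / n t) 0.
Proof.
  pose proof (recessive_p_infty q lam0 p m1 lam0_up p_solves p_right) as Z.
  assert (N : (m1, RtoC 0) <> (RtoC 0, RtoC 0)) by congruence.
  pose proof (fun f g x y => tends_projector (F := Rbar_locally p_infty)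
    (fun t => Cexp (Ci * lam0 * t)) f g p x y m1 0
    (fun t => Cexp_neq0 _) p_neq0 N p_right Z) as T.
  pose proof (Cconj_neq0 _ m1_neq0) as N1.
  repeat split.
  - refine (tends_eq _ _ _ _ (fun t => eq_refl) _ (T _ _ _ _ p_right p_right)).
    rewrite conj_RtoC. field. split; auto.
  - refine (tends_eq _ _ _ _ (fun t => eq_refl) _ (T _ _ _ _ p_right Z)).
    rewrite conj_RtoC. field. split; auto.
  - refine (tends_eq _ _ _ _ (fun t => eq_refl) _ (T _ _ _ _ Z p_right)).
    rewrite conj_RtoC. field. split; auto.
  - refine (tends_eq _ _ _ _ (fun t => eq_refl) _ (T _ _ _ _ Z Z)).
    rewrite conj_RtoC. field. split; auto.
Qed.

Lemma projector_left :
  tends (Rbar_locally m_infty) (fun t => fst (p t) * Cconj (fst (p t)) / n t) 0 /\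
  tends (Rbar_locally m_infty) (fun t => fst (p t) * Cconj (snd (p t)) / n t) 0 /\
  tends (Rbar_locally m_infty) (fun t => snd (p t) * Cconj (fst (p t)) / n t) 0 /\
  tends (Rbar_locally m_infty) (fun t => snd (p t) * Cconj (snd (p t)) / n t) 1.
Proof.
  pose proof (recessive_m_infty q lam0 p m2 lam0_up p_solves p_left) as Z.
  assert (N : (RtoC 0, m2) <> (RtoC 0, RtoC 0)) by congruence.
  pose proof (fun f g x y => tends_projector (F := Rbar_locally m_infty)
    (fun t => Cexp (- Ci * lam0 * t)) f g p x y 0 m2
    (fun t => Cexp_neq0 _) p_neq0 N Z p_left) as T.
  pose proof (Cconj_neq0 _ m2_neq0) as N2.
  repeat split.
  - refine (tends_eq _ _ _ _ (fun t => eq_refl) _ (T _ _ _ _ Z Z)).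
    rewrite conj_RtoC. field. split; auto.
  - refine (tends_eq _ _ _ _ (fun t => eq_refl) _ (T _ _ _ _ Z p_left)).
    rewrite conj_RtoC. field. split; auto.
  - refine (tends_eq _ _ _ _ (fun t => eq_refl) _ (T _ _ _ _ p_left Z)).
    rewrite conj_RtoC. field. split; auto.
  - refine (tends_eq _ _ _ _ (fun t => eq_refl) _ (T _ _ _ _ p_left p_left)).
    rewrite conj_RtoC. field. split; auto.
Qed.

Section Fixed_lambda.
Context (lam : C) (lam_up : (0 <= Im lam)%R).

Let k : C := (lam0 - Cconj lam0) / (lam - Cconj lam0).

Lemma dressed_jost_fst (e : R -> C) (phi : R -> C * C) (t : R) :
  e t * fst (dressed_jost lam phi t) =
  e t * fst (phi t) - k * (fst (p t) * Cconj (fst (p t)) / n t * (e t * fst (phi t)) +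
    fst (p t) * Cconj (snd (p t)) / n t * (e t * snd (phi t))).
Proof.
  unfold dressed_jost, cscale, dressed, overlap, k, n; cbn [fst snd].
  field. split; [apply sqnorm_C_neq0, p_neq0 | now apply Im_pos_neq_conj].
Qed.

Lemma dressed_jost_snd (e : R -> C) (phi : R -> C * C) (t : R) :
  e t * snd (dressed_jost lam phi t) =
  e t * snd (phi t) - k * (snd (p t) * Cconj (snd (p t)) / n t * (e t * snd (phi t)) +
    snd (p t) * Cconj (fst (p t)) / n t * (e t * fst (phi t))).
Proof.
  unfold dressed_jost, cscale, dressed, overlap, k, n; cbn [fst snd].
  field. split; [apply sqnorm_C_neq0, p_neq0 | now apply Im_pos_neq_conj].
Qed.

Lemma solves_t_dressed_jost (phi : R -> C * C) :
  solves_t q lam phi -> solves_t dressed_potential lam (dressed_jost lam phi).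
Proof. intros S. now apply solves_t_scale, solves_t_dressed. Qed.

Lemma dressed_jostN (phi : R -> C * C) :
  jostN q lam phi -> jostN dressed_potential lam (dressed_jost lam phi).
Proof.
  intros [S [H0 H1]]. destruct projector_left as [P11 [P12 [P21 P22]]].
  split; [now apply solves_t_dressed_jost | split].
  - refine (tends_eq _ _ _ _ (fun t => eq_refl) _
      (tends_dressed_entry _ _ _ _ _ k 0 1
        (dressed_jost_fst (fun t => Cexp (Ci * lam * t)) phi) P11 P12 H0
        (tends_eventually_bounded _ _ H1))). ring.
  - refine (tends_eq _ _ _ _ (fun t => eq_refl) _
      (tends_dressed_entry _ _ _ _ _ k 1 0
        (dressed_jost_snd (fun t => Cexp (Ci * lam * t)) phi) P22 P21 H1
        (tends_eventually_bounded _ _ H0))). ring.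
Qed.

Lemma dressed_jostP (phi : R -> C * C) :
  jostP q lam phi -> jostP dressed_potential lam (dressed_jost lam phi).
Proof.
  intros [S [H0 H1]]. destruct projector_right as [P11 [P12 [P21 P22]]].
  split; [now apply solves_t_dressed_jost | split].
  - refine (tends_eq _ _ _ _ (fun t => eq_refl) _
      (tends_dressed_entry _ _ _ _ _ k 1 0
        (dressed_jost_fst (fun t => Cexp (- Ci * lam * t)) phi) P11 P12 H0
        (tends_eventually_bounded _ _ H1))). ring.
  - refine (tends_eq _ _ _ _ (fun t => eq_refl) _
      (tends_dressed_entry _ _ _ _ _ k 0 1
        (dressed_jost_snd (fun t => Cexp (- Ci * lam * t)) phi) P22 P21 H1
        (tends_eventually_bounded _ _ H0))). ring.
Qed.

(** The dressing matrix has determinant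
    (lam - lam0) / (lam - conj(lam0)), which multiplies the Wronskian; its upper
    left entry has the same limit at plus infinity. *)
Lemma dressed_is_a (alpha : C) :
  is_a q lam alpha ->
  is_a dressed_potential lam ((lam - lam0) / (lam - Cconj lam0) * alpha).
Proof.
  intros [f [g [Nf [Pg [W T]]]]].
  assert (K : lam - Cconj lam0 <> 0) by now apply Im_pos_neq_conj.
  exists (dressed_jost lam f), (dressed_jost lam g).
  split; [now apply dressed_jostN | split; [now apply dressed_jostP | split]].
  - intros t. rewrite <- (W t).
    unfold dressed_jost, cscale, dressed, overlap; cbn [fst snd].
    field. split; [exact K | apply sqnorm_C_neq0, p_neq0].
  - destruct projector_right as [P11 [P12 _]].
    refine (tends_eq _ _ _ _ (fun t => eq_refl) _
      (tends_dressed_entry _ _ _ _ _ k 1 alpha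
        (dressed_jost_fst (fun t => Cexp (Ci * lam * t)) f) P11 P12 T _)).
    + unfold k. field. exact K.
    + exists 1%R. apply filter_forall. intros t.
      apply (Cmod_le_of_sqnorm (gauge lam f t) 1 Rle_0_1).
      rewrite pow1. now apply (jostN_sqnorm_le_1 q).
Qed.

(** Off the real axis the statement is proportionality of the two Jost
    solutions, which linearity of the dressing preserves. On the real axis it
    is a limit at plus infinity, where the lower right entry of the dressing
    matrix tends to 1. *)
Lemma dressed_is_b (beta : C) :
  is_b q lam beta -> is_b dressed_potential lam beta.
Proof.
  intros [f [g [Nf [Pg [T E]]]]].
  pose proof (dressed_jostP g Pg) as Pg'.
  assert (E' : (0 < Im lam)%R -> forall t, dressed_jost lam f t =
     (beta * fst (dressed_jost lam g t), beta * snd (dressed_jost lam g t))).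
  { intros L t. unfold dressed_jost. rewrite (E L t).
    unfold cscale, dressed, overlap; cbn [fst snd].
    f_equal; field; (split; [apply sqnorm_C_neq0, p_neq0 | now apply Im_pos_neq_conj]). }
  exists (dressed_jost lam f), (dressed_jost lam g).
  split; [now apply dressed_jostN | split; [exact Pg' | split; [| exact E']]].
  destruct lam_up as [L | L].
  - destruct Pg' as [_ [_ T']].
    refine (tends_eq _ _ _ _ _ _ (tends_mult _ _ _ _ (tends_const beta) T')); [| ring].
    intros t. cbv beta. rewrite (E' L t). cbn [fst snd]. ring.
  - destruct projector_right as [_ [_ [P21 P22]]].
    refine (tends_eq _ _ _ _ (fun t => eq_refl) _
      (tends_dressed_entry _ _ _ _ _ k 0 beta
        (dressed_jost_snd (fun t => Cexp (- Ci * lam * t)) f) P22 P21 T _)); [ring |].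
    exists 1%R. apply filter_forall. intros t.
    replace (Cmod (Cexp (- Ci * lam * t) * fst (f t))) with (Cmod (fst (gauge lam f t))).
    + apply (Cmod_le_of_sqnorm (gauge lam f t) 1 Rle_0_1).
      rewrite pow1. now apply (jostN_sqnorm_le_1 q).
    + unfold gauge, cscale; cbn [fst snd]. rewrite !Cmod_mult, !Cmod_Cexp. do 2 f_equal.
      destruct lam as [x y]. unfold Re, Im, Ci, Cmult, Copp, RtoC in *; simpl in *.
      rewrite <- L. ring.
Qed.

End Fixed_lambda.

(** The dressed Jost solutions at lam0 are multiples of the vector orthogonal
    to psi, with the Wronskians with psi as coefficients. Each Wronskian is
    constant and is evaluated at the end where the Jost solution is
    normalized. *)
Lemma dressed_is_b_lam0 (alpha : C) :
  is_a q lam0 alpha -> is_b dressed_potential lam0 (- (m2 / m1)).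
Proof.
  intros [f [g [Nf [Pg _]]]].
  assert (L : (0 <= Im lam0)%R) by lra.
  assert (K : lam0 - Cconj lam0 <> 0) by now apply Im_pos_neq_conj.
  (* The phases of psi and of the Jost solution compensate in the Wronskian. *)
  assert (Ph : forall t : R, Cexp (Ci * lam0 * t) * Cexp (- Ci * lam0 * t) = 1).
  { intros t. apply Cexp_inv. ring. }
  assert (Wf : forall t, fst (f t) * snd (p t) - snd (f t) * fst (p t) = m2).
  { intros t. destruct Nf as [S [H0 H1]].
    apply (tends_unique (F := Rbar_locally m_infty)
      (fun s => fst (f s) * snd (p s) - snd (f s) * fst (p s))).
    - refine (tends_eq _ _ _ _ _ eq_refl (tends_const _)). intros s.
      now apply (wronskian_constant q lam0).
    - refine (tends_eq _ _ _ _ _ _ (tends_minus _ _ _ _ (tends_mult _ _ _ _ H0 p_left)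
        (tends_mult _ _ _ _ H1
          (recessive_m_infty q lam0 p m2 lam0_up p_solves p_left)))); [| ring].
      intros s. cbv beta.
      replace (fst (f s) * snd (p s) - snd (f s) * fst (p s)) with
        (1 * (fst (f s) * snd (p s) - snd (f s) * fst (p s))) by ring.
      rewrite <- (Ph s). ring. }
  assert (Wg : forall t, fst (p t) * snd (g t) - snd (p t) * fst (g t) = m1).
  { intros t. destruct Pg as [S [H0 H1]].
    apply (tends_unique (F := Rbar_locally p_infty)
      (fun s => fst (p s) * snd (g s) - snd (p s) * fst (g s))).
    - refine (tends_eq _ _ _ _ _ eq_refl (tends_const _)). intros s.
      now apply (wronskian_constant q lam0).
    - refine (tends_eq _ _ _ _ _ _ (tends_minus _ _ _ _ (tends_mult _ _ _ _ p_right H1)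
        (tends_mult _ _ _ _
          (recessive_p_infty q lam0 p m1 lam0_up p_solves p_right) H0))); [| ring].
      intros s. cbv beta.
      replace (fst (p s) * snd (g s) - snd (p s) * fst (g s)) with
        (1 * (fst (p s) * snd (g s) - snd (p s) * fst (g s))) by ring.
      rewrite <- (Ph s). ring. }
  assert (Perp : forall (h : R -> C * C) t, dressed_jost lam0 h t =
    let w := (fst (h t) * snd (p t) - snd (h t) * fst (p t)) / n t in
    (Cconj (snd (p t)) * w, - Cconj (fst (p t)) * w)).
  { intros h t. unfold dressed_jost, cscale, dressed, overlap, n; cbn [fst snd].
    f_equal; field; (split; [apply sqnorm_C_neq0, p_neq0 | exact K]). }
  assert (E : forall t, dressed_jost lam0 f t =
    (- (m2 / m1) * fst (dressed_jost lam0 g t), - (m2 / m1) * snd (dressed_jost lam0 g t))).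
  { intros t. rewrite !Perp. cbv zeta. cbn [fst snd].
    replace (fst (g t) * snd (p t) - snd (g t) * fst (p t)) with (- m1)
      by (rewrite <- (Wg t); ring).
    rewrite (Wf t). pose proof (sqnorm_C_neq0 _ (p_neq0 t)) as Nn. fold (n t) in Nn.
    f_equal; field; auto. }
  pose proof (dressed_jostP lam0 L g Pg) as Pg'.
  exists (dressed_jost lam0 f), (dressed_jost lam0 g).
  split; [now apply dressed_jostN | split; [exact Pg' | split; [| now intros _]]].
  destruct Pg' as [_ [_ T]].
  refine (tends_eq _ _ _ _ _ _ (tends_mult _ _ _ _ (tends_const (- (m2 / m1))) T));
    [| ring].
  intros t. cbv beta. rewrite (E t). cbn [fst snd]. ring.
Qed.

End Scattering.

(** * Complex derivatives at a zero *)

Lemma is_C_derive_iff (f : C -> C) (z l : C) :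
  @is_derive C_AbsRing C_NormedModule f z l <->
  forall eps : posreal, exists delta : posreal, forall y,
    (Cmod (y - z) < delta)%R ->
    (Cmod (f y - f z - (y - z) * l) <= eps * Cmod (y - z))%R.
Proof.
  split.
  - intros [_ D] eps. exact (D z (fun P H => H) eps).
  - intros D. split; [apply is_linear_scal_l |].
    intros x Hx. rewrite <- (is_filter_lim_locally_unique _ _ Hx).
    intros eps. exact (D eps).
Qed.

(** As [w] vanishes at [z] it is O(y - z) there, so by continuity of [u] the
    product u w differs from u(z) w by o(y - z). *)
Lemma is_derive_mult_at_zero (f u w : C -> C) (z dw : C) (r : posreal) :
  (forall y, (Cmod (y - z) < r)%R -> f y = u y * w y) ->
  w z = 0 -> continuous u z ->
  @is_derive C_AbsRing C_NormedModule w z dw ->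
  @is_derive C_AbsRing C_NormedModule f z (u z * dw).
Proof.
  intros E Z U W. apply is_C_derive_iff. intros eps.
  pose proof (cond_pos eps) as Pe.
  pose proof (Cmod_ge_0 (u z)) as Pu. pose proof (Cmod_ge_0 dw) as Pd.
  set (e1 := (Rmin 1 (eps / (2 * (Cmod (u z) + 1))))%R).
  set (e2 := (eps / (2 * (Cmod dw + 1)))%R).
  assert (P1' : (0 < eps / (2 * (Cmod (u z) + 1)))%R) by (apply Rdiv_lt_0_compat; lra).
  assert (P1 : (0 < e1)%R) by (unfold e1; apply Rmin_pos; lra).
  assert (P2 : (0 < e2)%R) by (unfold e2; apply Rdiv_lt_0_compat; lra).
  destruct (proj1 (is_C_derive_iff w z dw) W (mkposreal e1 P1)) as [d1 H1].
  destruct (proj1 (continuous_C_iff u z) U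
    (mkposreal (Rmin 1 e2) ltac:(apply Rmin_pos; lra))) as [d2 H2].
  exists (mkposreal (Rmin r (Rmin d1 d2))
    ltac:(repeat apply Rmin_pos; apply cond_pos)). simpl in *.
  intros y Hy.
  pose proof (Rmin_l r (Rmin d1 d2)). pose proof (Rmin_r r (Rmin d1 d2)).
  pose proof (Rmin_l d1 d2). pose proof (Rmin_r d1 d2).
  specialize (H1 y ltac:(lra)). specialize (H2 y ltac:(lra)).
  rewrite Z in H1.
  rewrite (E y) by lra. rewrite (E z), Z.
  2: { replace (z - z) with (RtoC 0) by ring. rewrite Cmod_0. apply cond_pos. }
  replace (u y * w y - u z * 0 - (y - z) * (u z * dw)) with
    (u y * (w y - 0 - (y - z) * dw) + (u y - u z) * ((y - z) * dw)) by ring.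
  eapply Rle_trans; [apply Cmod_triangle |]. rewrite !Cmod_mult.
  pose proof (Rmin_l 1 e2). pose proof (Rmin_r 1 e2).
  pose proof (Rmin_r 1 (eps / (2 * (Cmod (u z) + 1)))) as He1. fold e1 in He1.
  assert (Uy : (Cmod (u y) <= Cmod (u z) + 1)%R).
  { pose proof (Cmod_triangle (u y - u z) (u z)) as T.
    replace (u y - u z + u z) with (u y) in T by ring. lra. }
  pose proof (Cmod_ge_0 (y - z)). pose proof (Cmod_ge_0 (u y)).
  pose proof (Cmod_ge_0 (u y - u z)). pose proof (Cmod_ge_0 (w y - 0 - (y - z) * dw)).
  assert (T1 : (Cmod (u y) * Cmod (w y - 0 - (y - z) * dw) <= eps / 2 * Cmod (y - z))%R).
  { apply Rle_trans with ((Cmod (u z) + 1) *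
      (eps / (2 * (Cmod (u z) + 1)) * Cmod (y - z)))%R.
    - apply Rmult_le_compat; try lra. eapply Rle_trans; [exact H1 |].
      apply Rmult_le_compat_r; lra.
    - right. field. lra. }
  assert (T2 : (Cmod (u y - u z) * (Cmod (y - z) * Cmod dw) <= eps / 2 * Cmod (y - z))%R).
  { apply Rle_trans with (e2 * (Cmod (y - z) * (Cmod dw + 1)))%R.
    - apply Rmult_le_compat; try nra.
    - right. unfold e2. field. lra. }
  lra.
Qed.

(** * The Darboux transformation *)

Lemma Cinv_neq0 (c : C) : c <> 0 -> / c <> 0.
Proof.
  intros N E. apply C1_nz. rewrite <- (Cinv_r c N), E. ring.
Qed.

Theorem theorem1
    (q : R -> R -> C) (a b : C -> C) (lam0 : C) (psi : R -> R -> C * C)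
    (q_smooth : smooth_potential q)
    (q_int : forall z : R, abs_integrable (fun t => q t z))
    (q_scat : scattering_functions (fun t => q t 0%R) a b)
    (lam0_up : (0 < Im lam0)%R)
    (a_lam0 : a lam0 <> 0)
    (psi_nontrivial : exists t z : R, psi t z <> (RtoC 0, RtoC 0))
    (psi_lax : solves_lax q lam0 psi) :
  (forall (mu : C) (v : R -> R -> C * C),
     solves_lax q mu v ->
     solves_lax (darboux lam0 psi q) mu
       (fun t z => act (subm (diag2 mu mu) (Sigma lam0 (psi t z))) (v t z)))
  /\
  (forall psi1p psi2m : C,
     psi1p <> 0 -> psi2m <> 0 ->
     tends (Rbar_locally p_infty)
       (fun t => Cexp (Ci * lam0 * t) * fst (psi t 0%R)) psi1p ->
     tends (Rbar_locally m_infty)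
       (fun t => Cexp (- Ci * lam0 * t) * snd (psi t 0%R)) psi2m ->
     let qt0 := fun t : R => darboux lam0 psi q t 0%R in
     (exists at_ bt : C -> C, scattering_functions qt0 at_ bt) /\
     (forall at_ bt : C -> C,
        scattering_functions qt0 at_ bt ->
        (forall lam : C,
           in_discrete_spectrum at_ lam <->
           in_discrete_spectrum a lam \/ lam = lam0 \/ lam = Cconj lam0) /\
        (forall lam : C, (0 <= Im lam)%R ->
           at_ lam = (lam - lam0) / (lam - Cconj lam0) * a lam) /\
        (forall lam : C, Im lam = 0%R \/ eigenvalue a lam -> bt lam = b lam) /\
        bt lam0 = - (psi2m / psi1p) /\
        (forall lam Qc : C, Im lam = 0%R -> is_Qc a b lam Qc ->
           is_Qc at_ bt lam ((lam - Cconj lam0) / (lam - lam0) * Qc)) /\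
        (forall lam Qd : C, eigenvalue a lam -> is_Qd a b lam Qd ->
           is_Qd at_ bt lam ((lam - Cconj lam0) / (lam - lam0) * Qd)) /\
        is_Qd at_ bt lam0 (- ((lam0 - Cconj lam0) / a lam0 * (psi2m / psi1p))))).
Proof.
  pose proof (lax_solution_neq0 q lam0 psi q_smooth psi_lax psi_nontrivial) as N.
  split; [intros mu v V; now apply solves_lax_dressed |].
  intros psi1p psi2m N1 N2 L1 L2 qt0.
  destruct q_scat as [A B].
  set (q0 := fun t => q t 0%R) in *. set (p := fun t => psi t 0%R).
  assert (S : solves_t q0 lam0 p) by exact (proj1 psi_lax 0%R).
  assert (Np : forall t, p t <> (RtoC 0, RtoC 0)) by (intros t; apply N).
  change (tends (Rbar_locally p_infty) (fun t => Cexp (Ci * lam0 * t) * fst (p t)) psi1p) in L1.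
  change (tends (Rbar_locally m_infty) (fun t => Cexp (- Ci * lam0 * t) * snd (p t)) psi2m) in L2.
  assert (Eq : qt0 = dressed_potential q0 lam0 p)
    by (apply functional_extensionality; intros t; apply darboux_dressed).
  assert (K : forall lam, (0 <= Im lam)%R -> lam - Cconj lam0 <> 0)
    by (intros lam P; now apply Im_pos_neq_conj).
  assert (At : forall lam, (0 <= Im lam)%R ->
     is_a qt0 lam ((lam - lam0) / (lam - Cconj lam0) * a lam)).
  { intros lam P. rewrite Eq. apply (dressed_is_a q0 lam0 p psi1p psi2m); auto; apply A, P. }
  assert (Bt : forall lam, Im lam = 0%R \/ eigenvalue a lam -> is_b qt0 lam (b lam)).
  { intros lam H. rewrite Eq. apply (dressed_is_b q0 lam0 p psi1p psi2m); auto.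
    destruct H as [-> | [P _]]; lra. }
  assert (Bt0 : is_b qt0 lam0 (- (psi2m / psi1p))).
  { rewrite Eq. apply (dressed_is_b_lam0 q0 lam0 p psi1p psi2m) with (a lam0); auto.
    apply A. lra. }
  assert (Zero : forall lam, (0 <= Im lam)%R ->
     (lam - lam0) / (lam - Cconj lam0) * a lam = 0 -> lam = lam0 \/ a lam = 0).
  { intros lam P H. destruct (Ceq_dec (a lam) 0) as [| Na]; [now right | left].
    destruct (Ceq_dec lam lam0) as [| Nl]; [assumption | exfalso].
    revert H. apply Cmult_neq_0; [| exact Na]. unfold Cdiv. apply Cmult_neq_0.
    - now apply Cminus_eq_contra.
    - now apply Cinv_neq0, K. }
  split.
  - exists (fun lam => (lam - lam0) / (lam - Cconj lam0) * a lam),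
      (fun lam => if Ceq_dec lam lam0 then - (psi2m / psi1p) else b lam).
    split; [exact At |]. intros lam H. destruct (Ceq_dec lam lam0) as [-> | Nl]; [exact Bt0 |].
    apply Bt. destruct H as [H | [P H]]; [now left | right].
    destruct (Zero lam (Rlt_le _ _ P) H); [contradiction | now split].
  - intros at_ bt [At' Bt'].
    assert (Ea : forall lam, (0 <= Im lam)%R ->
       at_ lam = (lam - lam0) / (lam - Cconj lam0) * a lam).
    { intros lam P. exact (is_a_unique _ _ _ _ P (At' lam P) (At lam P)). }
    assert (Ea0 : at_ lam0 = 0).
    { rewrite Ea by lra. field. apply K. lra. }
    assert (Ev : forall lam, eigenvalue at_ lam <-> eigenvalue a lam \/ lam = lam0).
    { intros lam. split.
      - intros [P H]. rewrite Ea in H by lra.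
        destruct (Zero lam (Rlt_le _ _ P) H); [now right | left; now split].
      - intros [[P H] | ->]; [| now split]. split; [exact P |].
        rewrite Ea, H by lra. ring. }
    assert (Eb : forall lam, Im lam = 0%R \/ eigenvalue a lam -> bt lam = b lam).
    { intros lam H.
      assert (P : (0 <= Im lam)%R) by (destruct H as [-> | [P _]]; lra).
      apply (is_b_unique qt0 lam _ _ P); [apply Bt' | now apply Bt].
      destruct H; [now left | right; apply Ev; now left]. }
    assert (Eb0 : bt lam0 = - (psi2m / psi1p)).
    { apply (is_b_unique qt0 lam0 _ _ (Rlt_le _ _ lam0_up)); [apply Bt' | exact Bt0].
      right. now split. }
    assert (Nb : forall lam y, (0 < Im lam)%R -> (Cmod (y - lam) < Im lam / 2)%R ->
        (0 <= Im y)%R).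
    { intros lam y P H. apply Im_ball in H. lra. }
    assert (Quot : forall f : C -> C, forall lam, (0 <= Im lam)%R -> continuous f lam ->
        continuous (fun y => f y / (y - Cconj lam0)) lam).
    { intros f lam P Hf. apply (tends_mult f); [exact Hf |].
      apply (tends_inv (fun y : C => y - Cconj lam0)); [now apply K |].
      apply (tends_minus (fun y : C => y)); [apply filterlim_id | apply tends_const]. }
    repeat split.
    + intros [H | H]; apply Ev in H; destruct H as [H | H].
      * left. now left.
      * right. now left.
      * left. now right.
      * right. right. now rewrite <- H, Cconj_conj.
    + intros [[H | H] | [-> | ->]].
      * left. apply Ev. now left.
      * right. apply Ev. now left.
      * left. apply Ev. now right.
      * right. rewrite Cconj_conj. apply Ev. now right.
    + exact Ea.
    + exact Eb.
    + exact Eb0.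
    + destruct H0 as [Na _]. rewrite Ea by lra. intros H1.
      destruct (Zero lam ltac:(lra) H1) as [-> | H2]; [lra | contradiction].
    + destruct H0 as [Na ->]. rewrite Ea, Eb by (try lra; now left).
      assert (Nl : lam - lam0 <> 0).
      { intros E. apply Ceq_minus in E. subst lam. lra. }
      field. split; [| split]; auto. apply K; lra.
    + intros lam Qd E [da [D [Nd ->]]]. destruct E as [P Za].
      assert (Nl : lam - lam0 <> 0).
      { intros E. apply Ceq_minus in E. subst lam. contradiction. }
      exists ((lam - lam0) / (lam - Cconj lam0) * da). split; [| split].
      * apply (is_derive_mult_at_zero at_ (fun y => (y - lam0) / (y - Cconj lam0)) a lam da
          (mkposreal (Im lam / 2) ltac:(lra))); auto.
        -- intros y Hy. apply Ea. now apply (Nb lam).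
        -- apply Quot; [lra |].
           apply (tends_minus (fun y : C => y)); [apply filterlim_id | apply tends_const].
      * unfold Cdiv. repeat apply Cmult_neq_0; auto.
        apply Cinv_neq0, K. lra.
      * rewrite Eb by (right; now split). field. repeat split; auto. apply K; lra.
    + exists (a lam0 / (lam0 - Cconj lam0) * 1). split; [| split].
      * apply (is_derive_mult_at_zero at_ (fun y => a y / (y - Cconj lam0))
          (fun y => y - lam0) lam0 1
          (mkposreal (Im lam0 / 2) ltac:(lra))).
        -- intros y Hy. pose proof (Nb lam0 y lam0_up Hy). rewrite Ea by assumption.
           field. now apply K.
        -- ring.
        -- apply Quot; [lra |]. now apply (continuous_a q0).
        -- apply is_C_derive_iff. intros eps. exists (mkposreal 1 Rlt_0_1). intros y _.
           replace (y - lam0 - (lam0 - lam0) - (y - lam0) * 1) with (RtoC 0) by ring.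
           rewrite Cmod_0. apply Rmult_le_pos; [left; apply cond_pos | apply Cmod_ge_0].
      * unfold Cdiv. repeat apply Cmult_neq_0; auto.
        -- apply Cinv_neq0, K. lra.
        -- intros H. now apply RtoC_inj, R1_neq_R0 in H.
      * rewrite Eb0. field. repeat split; auto. apply K; lra.
Qed.
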